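(* Let $Q=Q(d,d_0)$ be any compact Riemannian symmetric space of rank one, and let $\gamma(Q)=\langle\tau\rangle/\langle\theta^{\Delta}(\xi^{\natural})\rangle$ (equivalently, the constant with $\tau=\gamma(Q)\,\theta^{\Delta}(\xi^{\natural},\cdot,\cdot)$ on $Q\times Q$). Then $$\gamma(Q(d,d_0))=\frac{\sqrt\pi}{4}(d+d_0)\frac{\Gamma(d_0/2)}{\Gamma((d_0+1)/2)}=\frac{d+d_0}{2d_0}\,\gamma(S^{d_0}),$$ where $\gamma(S^{k})=\dfrac{k\sqrt\pi\,\Gamma(k/2)}{2\,\Gamma((k+1)/2)}$.
   Context: $Q(d,d_0)$: either a sphere $S^d=\{x\in\mathbb R^{d+1}:\|x\|=1\}$ ($d\ge1$, $d_0=d$, $\theta$ the great-circle distance), or a projective space $\mathbb F P^n$, $\mathbb F\in\{\mathbb R,\mathbb C,\mathbb H,\mathbb O\}$, $d_0=\dim_{\mathbb R}\mathbb F$, $d=nd_0$, $n\ge2$, $n=2$ if $\mathbb F=\mathbb O$, modeled as $\{\Pi\in\mathcal H(\mathbb F^{n+1}):\Pi^2=\Pi,\mathrm{Tr}\,\Pi=1\}$ (Hermitian matrices, $\langle A,B\rangle=\mathrm{Re}\,\mathrm{Tr}\,AB$) with invariant Riemannian distance $\theta\in[0,\pi]$ normalized to diameter $\pi$, $\cos^2(\theta(\Pi_1,\Pi_2)/2)=\langle\Pi_1,\Pi_2\rangle$. $\mu$ is the invariant measure with $\mu(Q)=1$. $\tau(x_1,x_2)=\sin\frac12\theta(x_1,x_2)$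 (chordal metric). $d\xi^{\natural}(r)=\sin r\,dr$ on $[0,\pi]$. $B(y,r)=\{x:\theta(x,y)<r\}$; $\theta^{\Delta}(\xi,y_1,y_2)=\frac12\int_0^\pi\mu(B(y_1,r)\Delta B(y_2,r))\,d\xi(r)$. For a metric $\rho$, $\langle\rho\rangle=\int_{Q\times Q}\rho(y_1,y_2)\,d\mu(y_1)d\mu(y_2)$. *)

(* Defs.v *)
From HB Require Import structures.
From mathcomp Require Import all_boot all_order all_algebra.
From mathcomp Require Import all_classical all_reals all_analysis.

Set Implicit Arguments.
Unset Strict Implicit.
Unset Printing Implicit Defensive.

Import Order.TTheory GRing.Theory Num.Theory.
Import numFieldNormedType.Exports.

Local Open Scope classical_set_scope.
Local Open Scope ring_scope.

Section MetricMeasure.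
Context {R : realType} {T : pointedType}.
Implicit Type theta rho : T -> T -> R.

Definition oball theta (y : T) (r : R) : set T := [set x | theta x y < r].

Definition metric_open theta : set (set T) :=
  [set A | forall x, A x -> exists2 r, 0 < r & oball theta x r `<=` A].

(* [T] with the Borel sigma-algebra of the topology of [theta] *)
Definition borel theta := g_sigma_algebraType (metric_open theta).

HB.instance Definition _ theta := Measurable.on (borel theta).

Definition isometry theta (g : T -> T) : Prop :=
  bijective g /\ forall x y, theta (g x) (g y) = theta x y.

(* by Myers-Steenrod, the bijective distance-preserving maps are the isometry
   group of the Riemannian manifold *)
Definition invariant_measure theta (mu : {measure set (borel theta) -> \bar R})
    : Prop :=
  forall g : T -> T, isometry theta g ->
  forall A : set (borel theta), measurable A -> mu (g @^-1` A) = mu A.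

Definition chordal theta (x y : T) : R := sin (theta x y / 2).

Definition mean theta (mu : probability (borel theta) R) rho : R :=
  (\int[(mu \x mu)%E]_z rho z.1 z.2)%R.

(* [theta^Delta(xi, y1, y2)] for the measure [d xi(r) = w r dr] on [[0, pi]] *)
Definition theta_delta theta (mu : probability (borel theta) R) (w : R -> R)
    (y1 y2 : T) : R :=
  2^-1 * (\int[@lebesgue_measure R]_(r in `[0, pi])
            (fine (mu (oball theta y1 r `+` oball theta y2 r)) * w r))%R.

(* the density of [xi^natural] is [sin] *)
Definition gamma theta (mu : probability (borel theta) R) : R :=
  mean mu (chordal theta) / mean mu (theta_delta mu sin).

End MetricMeasure.

(* meaningful for [0 < s] *)
Definition Gamma {R : realType} (s : R) : R :=
  (\int[@lebesgue_measure R]_(t in `]0, +oo[) (t `^ (s - 1) * expR (- t)))%R.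

Section Sphere.
Context (R : realType).

Definition dot n (x y : 'rV[R]_n) : R := \sum_i x 0 i * y 0 i.

(* the library norm of ['rV[R]_n] is the sup norm *)
Definition euclid n (x : 'rV[R]_n) : R := Num.sqrt (dot x x).

Definition sphere (d : nat) := {x : 'rV[R]_d.+1 | euclid x == 1}.

Lemma sphere_basepoint d : euclid (delta_mx 0 0 : 'rV[R]_d.+1) == 1.
Proof.
rewrite /euclid /dot (bigD1 0) //= big1 => [|i /negPf i0].
  by rewrite !mxE !eqxx mulr1 addr0 sqrtr1.
by rewrite !mxE i0 andbF mulr0.
Qed.

HB.instance Definition _ d := Choice.on (sphere d).
HB.instance Definition _ d :=
  isPointed.Build (sphere d)
    (@exist _ (fun x => euclid x == 1) _ (sphere_basepoint d)).

Definition sphere_dist d (x y : sphere d) : R := acos (dot (val x) (val y)).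

End Sphere.

Section CayleyDickson.
Context (R : realType).

(* [cd 0], [cd 1], [cd 2], [cd 3] are the reals, the complex numbers, the
   quaternions and the octonions *)
Fixpoint cd (k : nat) : zmodType :=
  if k is k'.+1 then (cd k' * cd k')%type else R.

Fixpoint cd_one k : cd k :=
  match k return cd k with 0 => 1 : R | k'.+1 => (cd_one k', 0) end.

Fixpoint cd_conj k : cd k -> cd k :=
  match k return cd k -> cd k with
  | 0 => fun a => a
  | k'.+1 => fun p => (cd_conj p.1, - p.2)
  end.

Fixpoint cd_mul k : cd k -> cd k -> cd k :=
  match k return cd k -> cd k -> cd k with
  | 0 => fun a b : R => a * b
  | k'.+1 => fun p q =>
      (cd_mul p.1 q.1 - cd_mul (cd_conj q.2) p.2,
       cd_mul q.2 p.1 + cd_mul p.2 (cd_conj q.1))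
  end.

Fixpoint cd_re k : cd k -> R :=
  match k return cd k -> R with
  | 0 => fun a => a
  | k'.+1 => fun p => cd_re p.1
  end.

(* [*m] is not available, since the octonions are not associative *)
Definition cd_mulmx k n (A B : 'M[cd k]_n) : 'M[cd k]_n :=
  \matrix_(i, j) \sum_l cd_mul (A i l) (B l j).

Definition cd_hermitian k n (A : 'M[cd k]_n) : bool :=
  map_mx (@cd_conj k) A^T == A.

Definition cd_inner k n (A B : 'M[cd k]_n) : R := cd_re (\tr (cd_mulmx A B)).

Definition projector k n (A : 'M[cd k]_n) : bool :=
  [&& cd_hermitian A, cd_mulmx A A == A & \tr A == cd_one k].

Definition projective (k n : nat) := {A : 'M[cd k]_n.+1 | projector A}.

Lemma cd_conj0 k : cd_conj (0 : cd k) = 0.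
Proof. by elim: k => [//|k IH]; rewrite /= IH oppr0. Qed.

Lemma cd_conj1 k : cd_conj (cd_one k) = cd_one k.
Proof. by elim: k => [//|k IH]; rewrite /= IH oppr0. Qed.

Lemma cd_mul0 k (a : cd k) : cd_mul 0 a = 0 /\ cd_mul a 0 = 0.
Proof.
elim: k a => [|k IH] a /=; first by rewrite mul0r mulr0.
by rewrite cd_conj0 !(IH _).1 !(IH _).2 subrr addr0.
Qed.

Lemma cd_mul11 k : cd_mul (cd_one k) (cd_one k) = cd_one k.
Proof.
elim: k => [|k IH] /=; first by rewrite mulr1.
by rewrite IH cd_conj0 cd_conj1 !(cd_mul0 _).1 subr0 addr0.
Qed.

Definition cd_e00 k n : 'M[cd k]_n.+1 :=
  \matrix_(i, j) if (i == 0) && (j == 0) then cd_one k else 0.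

Lemma projective_basepoint k n : projector (cd_e00 k n).
Proof.
apply/and3P; split.
- apply/eqP/matrixP => i j; rewrite !mxE andbC.
  by case: ifP; rewrite ?cd_conj1 ?cd_conj0.
- apply/eqP/matrixP => i j; rewrite !mxE (bigD1 0) //= big1 => [|l /negPf l0].
    rewrite !mxE eqxx andbT addr0 /=.
    case: eqP => _; case: eqP => _ /=;
      by rewrite ?cd_mul11 ?(cd_mul0 _).1 ?(cd_mul0 _).2.
  by rewrite !mxE l0 andbF (cd_mul0 _).1.
- rewrite /mxtrace (bigD1 0) //= big1 => [|i /negPf i0].
    by rewrite !mxE eqxx addr0.
  by rewrite !mxE i0.
Qed.

HB.instance Definition _ k n := Choice.on (projective k n).
HB.instance Definition _ k n :=
  isPointed.Build (projective k n)
    (@exist _ (fun A => projector A) _ (projective_basepoint k n)).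

(* the [theta] in [[0, pi]] with [cos^2 (theta / 2) = cd_inner A B] *)
Definition projective_dist k n (A B : projective k n) : R :=
  2 * acos (Num.sqrt (cd_inner (val A) (val B))).

End CayleyDickson.

Variant hurwitz := Reals | Complexes | Quaternions | Octonions.

Definition cd_level (F : hurwitz) : nat :=
  match F with
  | Reals => 0
  | Complexes => 1
  | Quaternions => 2
  | Octonions => 3
  end.

Definition hurwitz_dim (F : hurwitz) : nat := 2 ^ cd_level F.

Variant rank_one_space := Sphere of nat | Projective of hurwitz & nat.

Definition admissible (Q : rank_one_space) : Prop :=
  match Q with
  | Sphere d => (1 <= d)%N
  | Projective F n => (2 <= n)%N /\ (F = Octonions -> n = 2%N)
  end.

(* the parameters [d] and [d_0] of [Q(d, d_0)] *)
Definition param_d (Q : rank_one_space) : nat :=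
  match Q with Sphere d => d | Projective F n => n * hurwitz_dim F end.

Definition param_d0 (Q : rank_one_space) : nat :=
  match Q with Sphere d => d | Projective F _ => hurwitz_dim F end.

Section RankOneSpace.
Context (R : realType).

Definition point_of (Q : rank_one_space) : pointedType :=
  match Q with
  | Sphere d => sphere R d
  | Projective F n => projective R (cd_level F) n
  end.

Definition dist (Q : rank_one_space) : point_of Q -> point_of Q -> R :=
  match Q return point_of Q -> point_of Q -> R with
  | Sphere d => @sphere_dist R d
  | Projective F n => @projective_dist R (cd_level F) n
  end.

End RankOneSpace.

(* Main.v *)
From HB Require Import structures.
From mathcomp Require Import all_boot all_order all_algebra.
From mathcomp Require Import all_classical all_reals all_analysis.
From mathcomp Require Import measurable_realfun ring lra zify.
Require Import Defs.

(* Let s(x, y) = cos^2(theta(x, y) / 2).  Then tau = sqrt (1 - s), and by Fubini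
   theta^Delta(y1, y2) is the integral of |s(x, y1) - s(x, y2)| over x, so
   gamma depends only on the law of s(., y), which by homogeneity does not depend
   on y.  Along a geodesic y_z through y, s(x, y_z) is a quadratic polynomial in z
   divided by 1 + z^2, and the moments of s(., y_z) are constant in z; the
   coefficient of z^2, summed over the d coordinate directions, gives
     (d + d0 + 2m - 2) E[s^m] = (d0 + 2m - 2) E[s^(m-1)].
   These are the moments of sin^2 r for the density sin^(d0-1) cos^(d-1) on
   [0, pi/2].  Approximating square roots by polynomials transfers E[sqrt (1 - s)]
   and E|s - s'| = E[sqrt ((s - s')^2)] to this density, where they are ratios of
   Wallis integrals.
   On the projective spaces transitivity is shown by conjugating a projector with
   entrywise phases (for the octonions: triality) and real reflections until only
   its (0, 0) entry survives. *)

Set Implicit Arguments.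
Unset Strict Implicit.
Unset Printing Implicit Defensive.

Import Order.TTheory GRing.Theory Num.Theory.
Import numFieldNormedType.Exports.

Local Open Scope classical_set_scope.
Local Open Scope ring_scope.

(** * Fubini for bounded functions *)

Section BoundedIntegrals.
Context d1 d2 (T1 : measurableType d1) (T2 : measurableType d2) (R : realType).

Lemma bounded_integrable (m : {finite_measure set T1 -> \bar R}) (D : set T1)
    (f : T1 -> R) (M : R) : measurable D ->
  measurable_fun D f -> (forall x, D x -> `|f x| <= M) -> m.-integrable D (EFin \o f).
Proof.
move=> mD mf fM; apply: measurable_bounded_integrable => //.
  rewrite (le_lt_trans (le_measure m _ _ (subsetT D))) ?inE//.
  by rewrite ltey_eq fin_num_measure.
exists M; split; first exact: num_real.
by move=> x Mx y Dy; apply: le_trans (fM _ Dy) (ltW Mx).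
Qed.

Lemma normr_Rintegral_le (m : {finite_measure set T1 -> \bar R}) (D : set T1)
    (f : T1 -> R) (M : R) : measurable D ->
  measurable_fun D f -> (forall x, D x -> `|f x| <= M) ->
  `|(\int[m]_(x in D) f x)%R| <= M * fine (m D).
Proof.
move=> mD mf fM; have fi := bounded_integrable m mD mf fM.
apply: le_trans (le_normr_Rintegral mD fi) _; rewrite -Rintegral_cst//.
apply: le_Rintegral => //.
- apply: (@bounded_integrable m D (fun x => `|f x|) M) => //; first exact: measurableT_comp.
  by move=> x Dx; rewrite normr_id fM.
- apply: (@bounded_integrable m D (cst M) `|M|) => //.
Qed.

Variables (m1 : {finite_measure set T1 -> \bar R})
          (m2 : {sigma_finite_measure set T2 -> \bar R}).
Variables (f : T1 * T2 -> R) (M : R).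
Hypotheses (mf : measurable_fun setT f) (fM : forall z, `|f z| <= M).

Section Restricted.
Variable D : set T2.
Hypotheses (mD : measurable D) (m2D : (m2 D < +oo)%E).

Let g (z : T1 * T2) : \bar R := (f z * \1_D z.2)%:E.

Let mg : measurable_fun [set: T1 * T2] g.
Proof.
apply/measurable_EFinP; apply: measurable_funM => //.
by apply: measurableT_comp => //; exact: measurable_indic.
Qed.

Let M0 : 0 <= M. Proof. exact: le_trans (fM point). Qed.

Let gM z : (`|g z| <= (M * \1_D z.2)%:E)%E.
Proof. by rewrite /g /= lee_fin normrM ler_pM// ger0_norm. Qed.

Let intD : (\int[m2]_y (M * \1_D y)%:E = M%:E * m2 D)%E.
Proof.
under eq_integral do rewrite EFinM.
rewrite ge0_integralZl_EFin//.
- by rewrite integral_indic// setIT.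
- by apply/measurable_EFinP; exact: measurable_indic.
Qed.

Let gi : (m1 \x m2)%E.-integrable [set: T1 * T2] g.
Proof.
apply/integrable12ltyP => //.
apply: (@le_lt_trans _ _ (\int[m1]_x (M%:E * m2 D))%E).
  apply: ge0_le_integral => //.
  - by move=> x _; apply: integral_ge0.
  - apply: (measurable_fun_fubini_tonelli_F (fun z => `|g z|)%E) => //.
    exact: measurableT_comp.
  - move=> x _; rewrite -intD; apply: ge0_le_integral => //.
    + apply: measurableT_comp => //.
      by apply: measurableT_comp => //; exact: pair1_measurable.
    + by apply/measurable_EFinP; apply: measurable_funM => //; exact: measurable_indic.
have m2Df : m2 D \is a fin_num by rewrite ge0_fin_numE.
by rewrite integral_cst// ltey_eq !fin_numM// fin_num_measure.
Qed.

Let patchE x : (fun y => f (x, y)) \_ D = (fun y => f (x, y) * \1_D y).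
Proof. by apply/funext => y; rewrite patch_indic. Qed.

Let section1 x : (\int[m2]_y g (x, y))%E = (\int[m2]_(y in D) f (x, y))%R%:E.
Proof.
rewrite Rintegral_mkcond patchE /Rintegral fineK//.
apply: integrable_fin_num => //.
have h : m2.-integrable setT (EFin \o (fun y => M * \1_D y)).
  apply/integrableP; split.
    by apply/measurable_EFinP; apply: measurable_funM => //; exact: measurable_indic.
  rewrite (eq_integral (fun y => (M * \1_D y)%:E)) ?intD//.
    by rewrite ltey_eq fin_numM// ge0_fin_numE.
  by move=> y _; rewrite /= ger0_norm// mulr_ge0.
apply: le_integrable h => //.
  apply/measurable_EFinP; apply: measurable_funM; last exact: measurable_indic.
  by apply: measurableT_comp => //; exact: pair1_measurable.
move=> y _; by apply: le_trans (gM (x, y)) _; rewrite lee_fin ler_norm.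
Qed.

Let section2 y : (\int[m1]_x g (x, y))%E = ((\int[m1]_x f (x, y))%R * \1_D y)%:E.
Proof.
have fi : m1.-integrable setT (EFin \o (fun x => f (x, y))).
  apply: (bounded_integrable (f := fun x => f (x, y)) m1 measurableT).
    exact: measurableT_comp mf (pair2_measurable y).
  by move=> x _; exact: fM.
rewrite -RintegralZr// /Rintegral fineK//.
apply: integrable_fin_num => //.
by under eq_fun do rewrite EFinM; exact: integrableZr.
Qed.

Lemma Rfubini :
  (\int[m1]_x (\int[m2]_(y in D) f (x, y)) =
   \int[m2]_(y in D) (\int[m1]_x f (x, y)))%R.
Proof.
have := Fubini gi.
under eq_integral do rewrite section1.
under [RHS]eq_integral do rewrite section2.
move=> /(congr1 fine); rewrite -!/(Rintegral _ _ _) => ->.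
by rewrite [RHS]Rintegral_mkcond patch_indic.
Qed.

Lemma Rintegral_section_integrable :
  m1.-integrable setT (EFin \o (fun x => \int[m2]_(y in D) f (x, y))%R).
Proof.
apply: eq_integrable (integrable_fubini_F gi) => // x _.
by rewrite /fubini_F section1.
Qed.

Lemma Rintegral_prod_indic :
  (\int[(m1 \x m2)%E]_z (f z * \1_D z.2) =
   \int[m1]_x \int[m2]_(y in D) f (x, y))%R.
Proof.
rewrite [RHS]/Rintegral; under eq_integral do rewrite -section1//.
by rewrite (integral12_prod_meas1 gi).
Qed.

End Restricted.

Lemma Rintegral_prod (m2T : (m2 setT < +oo)%E) :
  (\int[(m1 \x m2)%E]_z f z = \int[m1]_x \int[m2]_y f (x, y))%R.
Proof.
rewrite -Rintegral_prod_indic//; apply: eq_Rintegral => z _.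
by rewrite indicT mulr1.
Qed.

End BoundedIntegrals.

(** * Polynomial approximation of the square root *)

Section SqrtPoly.
Variable R : realType.

(* Visser's iteration [p := p + (x - p^2) / 2], increasing to [sqrt x]. *)
Fixpoint sqrt_poly (n : nat) : {poly R} :=
  if n is n'.+1 then
    sqrt_poly n' + 2^-1 *: ('X - sqrt_poly n' ^+ 2)
  else 0.

Lemma sqrt_poly_bounds n (x : R) : 0 <= x <= 1 ->
  0 <= (sqrt_poly n).[x] <= Num.sqrt x /\
  (Num.sqrt x - (sqrt_poly n).[x]) * (2 + n%:R * Num.sqrt x) <= 2 * Num.sqrt x.
Proof.
move=> /andP[x0 x1]; set y := Num.sqrt x.
have y0 : 0 <= y by exact: sqrtr_ge0.
have y2 : y ^+ 2 = x by rewrite sqr_sqrtr.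
have y1 : y <= 1 by rewrite -(sqrtr1 R) ler_sqrt.
elim: n => [|n [/andP[p0 py] IH]] /=; first by rewrite horner0; split; lra.
set p := (sqrt_poly n).[x] in p0 py IH *.
have n0 : 0 <= n%:R :> R by [].
have -> : (sqrt_poly n + 2^-1 *: ('X - sqrt_poly n ^+ 2)).[x]
    = y - (y - p) * (1 - (y + p) / 2).
  rewrite hornerD hornerZ hornerD hornerN hornerX horner_exp -/p -[in LHS]y2.
  by field.
split.
  apply/andP; split; first nra.
  rewrite lerBlDr lerDl mulr_ge0//; lra.
rewrite opprB addrC subrK -[n.+1%:R]natr1.
have : (1 - (y + p) / 2) * (2 + (n%:R + 1) * y) <= 2 + n%:R * y.
  by have := mulr_ge0 n0 (mulr_ge0 y0 (addr_ge0 y0 p0)); nra.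
move=> h; apply: le_trans IH; rewrite -mulrA ler_wpM2l ?subr_ge0//.
Qed.

Lemma sqrt_poly_approx n (x : R) : 0 <= x <= 1 ->
  `|Num.sqrt x - (sqrt_poly n.+1).[x]| <= 2 / n.+1%:R.
Proof.
move=> x01; have [/andP[p0 py] h] := sqrt_poly_bounds n.+1 x01.
set y := Num.sqrt x in py h *.
have y0 : 0 <= y by exact: sqrtr_ge0.
rewrite ger0_norm ?subr_ge0//.
move: y0; rewrite le_eqVlt => /predU1P[ye|y0].
  rewrite -ye in py *; rewrite (le_trans (_ : _ <= 0))//; first lra.
rewrite ler_pdivlMr// -(ler_pM2r y0); nra.
Qed.

End SqrtPoly.

(** * Wallis integrals *)

Section WallisIntegrals.
Variable R : realType.
Notation leb := (@lebesgue_measure R).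
Implicit Types (f F : R -> R) (a b x : R).

Definition primitive_on a b f F := forall x, a <= x <= b -> is_derive x 1 F (f x).

Lemma FTC2_is_derive f F a b : a <= b ->
  {within `[a, b], continuous f} -> primitive_on a b f F ->
  \int[leb]_(x in `[a, b]) f x = F b - F a.
Proof.
rewrite le_eqVlt => /predU1P[<- _ _|ab cf dF].
  by rewrite set_itv1 Rintegral_set1 subrr.
have cF x : a <= x <= b -> {for x, continuous F}.
  move=> /dF [dFx _]; apply: differentiable_continuous.
  exact/derivable1_diffP.
rewrite /Rintegral (@continuous_FTC2 _ f F a b)//.
- split.
  + move=> x /andP[ax xb]; have [|//] := dF x.
    by move: ax xb; rewrite !bnd_simp => /ltW -> /ltW ->.
  + by apply: cvg_at_right_filter; apply: cF; rewrite lexx ltW.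
  + by apply: cvg_at_left_filter; apply: cF; rewrite lexx ltW.
- move=> x /andP[ax xb]; rewrite derive1E.
  have xab : a <= x <= b by move: ax xb; rewrite !bnd_simp => /ltW -> /ltW ->.
  by have [_ ->] := dF x xab.
Qed.

Lemma continuous_primitive f : continuous f ->
  exists F, F 0 = 0 /\ forall x, 0 <= x -> is_derive x 1 F (f x).
Proof.
move=> cf; pose F x := \int[leb]_(t in `[-1, x]) f t.
exists (fun x => F x - F 0); split; first by rewrite subrr.
move=> x x0.
have fi : leb.-integrable `[-1, (x + 1)] (EFin \o f).
  apply: continuous_compact_integrable; first exact: segment_compact.
  exact: continuous_subspaceT.
have xx : x < x + 1 by rewrite ltrDl.
have x1 : -1 < x by apply: lt_le_trans x0; rewrite ltrN10.
have [dF F'] := continuous_FTC1_closed xx fi x1 (cf x).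
have isF : is_derive x 1 F (f x).
  by split; [exact: dF|rewrite -derive1E].
rewrite -[f x]subr0; exact: is_deriveB.
Qed.

Definition wallis (p q : nat) : R :=
  \int[leb]_(x in `[0, (pi / 2)]) (sin x ^+ p * cos x ^+ q).

Lemma continuous_wallis p q : continuous (fun x : R => sin x ^+ p * cos x ^+ q).
Proof.
have cX (f : R -> R) n : continuous f -> continuous (fun x => f x ^+ n).
  by move=> cf x; apply: (@cvg_comp _ _ _ f (fun y => y ^+ n) _ _ _ (cf x)); exact: exprn_continuous.
by move=> x; apply: cvgM; apply: cX; [exact: continuous_sin|exact: continuous_cos].
Qed.

Lemma pi2_ge0 : 0 <= pi / 2 :> R.
Proof. by rewrite divr_ge0// pi_ge0. Qed.

Lemma is_derive_wallis p q x :
  is_derive x 1 (fun x : R => sin x ^+ p.+1 * cos x ^+ q.+1)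
    (sin x ^+ p * cos x ^+ q * (p.+1%:R - (p + q).+2%:R * sin x ^+ 2)).
Proof.
have h := is_deriveM (is_deriveX p.+1 (is_derive_sin x)) (is_deriveX q.+1 (is_derive_cos x)).
rewrite (_ : (fun _ => _) = sin ^+ p.+1 * cos ^+ q.+1 :> (R -> R)); last first.
  by apply/funext => y; rewrite /= !exprfctE.
apply: is_derive_eq h _; rewrite !exprfctE /= /GRing.scale /=.
have c2 : cos x * cos x = 1 - sin x * sin x.
  by rewrite -(cos2Dsin2 x) !expr2 addrK.
rewrite !exprS expr0 -!natr1 natrD.
transitivity (sin x ^+ p * cos x ^+ q *
    ((p%:R + 1) * (cos x * cos x) - (q%:R + 1) * (sin x * sin x))); first by ring.
by rewrite c2; ring.
Qed.

Lemma continuous_itv_integrable f a b : continuous f ->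
  leb.-integrable `[a, b] (EFin \o f).
Proof.
move=> cf; apply: continuous_compact_integrable; first exact: segment_compact.
exact: continuous_subspaceT.
Qed.

Lemma continuous_exprD2 p q f : continuous f ->
  continuous (fun x => sin x ^+ p * cos x ^+ q * f x).
Proof. by move=> cf x; apply: cvgM; [exact: continuous_wallis|exact: cf]. Qed.

Lemma wallis_sinSS p q : (p + q).+2%:R * wallis p.+2 q = p.+1%:R * wallis p q.
Proof.
have E : \int[leb]_(x in `[0, (pi / 2)]) (sin x ^+ p * cos x ^+ q *
    (p.+1%:R - (p + q).+2%:R * sin x ^+ 2)) = 0.
  rewrite (@FTC2_is_derive _ (fun x : R => sin x ^+ p.+1 * cos x ^+ q.+1)).
  - by rewrite sin0 cos_pihalf !exprS !mul0r mulr0 subrr.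
  - exact: pi2_ge0.
  - apply: continuous_subspaceT; apply: continuous_exprD2 => x; apply: cvgB; first exact: cvg_cst.
    apply: cvgM; first exact: cvg_cst.
    exact: (@cvg_comp _ _ _ sin (fun y => y ^+ 2) _ _ _ (@continuous_sin R x)
      (@exprn_continuous R 2 _)).
  - by move=> x _; exact: is_derive_wallis.
apply/eqP; rewrite eq_sym -subr_eq0 -E; apply/eqP.
rewrite /wallis -!RintegralZl//; try exact/continuous_itv_integrable/continuous_wallis.
rewrite -RintegralB//.
- by apply: eq_Rintegral => x _; rewrite !exprS; ring.
- apply: continuous_itv_integrable => x; apply: cvgM; first exact: cvg_cst.
  exact: continuous_wallis.
- apply: continuous_itv_integrable => x; apply: cvgM; first exact: cvg_cst.
  exact: continuous_wallis.
Qed.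

Lemma wallis_split p q : wallis p q = wallis p.+2 q + wallis p q.+2.
Proof.
rewrite /wallis -RintegralD//; try exact/continuous_itv_integrable/continuous_wallis.
apply: eq_Rintegral => x _.
have c2 : cos x * cos x = 1 - sin x * sin x.
  by rewrite -(cos2Dsin2 x) !expr2 addrK.
have -> : cos x ^+ q.+2 = cos x ^+ q * (1 - sin x * sin x).
  by rewrite -c2 !exprSr mulrA.
by rewrite !exprS; ring.
Qed.

Lemma wallis_cosSS p q : (p + q).+2%:R * wallis p q.+2 = q.+1%:R * wallis p q.
Proof.
have := wallis_sinSS p q; have := wallis_split p q => E1 E2.
have -> : wallis p q.+2 = wallis p q - wallis p.+2 q by rewrite [X in X - _]E1 addrC addKr.
by rewrite mulrBr E2 -mulrBl -!natr1 natrD; ring.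
Qed.

Lemma wallis00 : wallis 0 0 = pi / 2.
Proof.
rewrite /wallis (@FTC2_is_derive _ id) ?subr0 ?pi2_ge0//; first exact/continuous_subspaceT/continuous_wallis.
by move=> x _; rewrite !expr0 mulr1; exact: is_derive_id.
Qed.

Lemma wallis01 : wallis 0 1 = 1.
Proof.
rewrite /wallis (@FTC2_is_derive _ sin) ?pi2_ge0//.
- by rewrite sin_pihalf sin0 subr0.
- exact/continuous_subspaceT/continuous_wallis.
- by move=> x _; rewrite expr0 mul1r expr1; exact: is_derive_sin.
Qed.

Lemma wallis10 : wallis 1 0 = 1.
Proof.
rewrite /wallis (@FTC2_is_derive _ (fun x => - cos x)) ?pi2_ge0//.
- by rewrite cos_pihalf cos0 oppr0 opprK add0r.
- exact/continuous_subspaceT/continuous_wallis.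
- move=> x _; rewrite expr0 mulr1 expr1 -[sin x]opprK; exact: is_deriveN.
Qed.

Lemma wallis11 : wallis 1 1 = 2^-1.
Proof.
rewrite /wallis (@FTC2_is_derive _ (fun x : R => 2^-1 * sin x ^+ 2)) ?pi2_ge0//.
- by rewrite sin_pihalf sin0 expr1n expr0n/= mulr0 subr0 mulr1.
- exact/continuous_subspaceT/continuous_wallis.
- move=> x _; have h := is_deriveX 2 (is_derive_sin x).
  apply: is_derive_eq (is_deriveZ 2^-1 h) _.
  by rewrite /GRing.scale /= expr1 !expr1; field.
Qed.

Lemma wallis_gt0 p q : 0 < wallis p q.
Proof.
elim: {q}q.+1 {-2}q (ltnSn q) p => // n IHq [|[|q]] nq.
- move=> p; elim: {p}p.+1 {-2}p (ltnSn p) => // m IHp [|[|p]] mp.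
  + by rewrite wallis00 divr_gt0// pi_gt0.
  + by rewrite wallis10.
  + have := IHp p (ltnW mp) => h.
    by rewrite -(pmulr_rgt0 _ (ltr0Sn R (p + 0).+1)) wallis_sinSS mulr_gt0.
- move=> p; elim: {p}p.+1 {-2}p (ltnSn p) => // m IHp [|[|p]] mp.
  + by rewrite wallis01.
  + by rewrite wallis11 invr_gt0.
  + have := IHp p (ltnW mp) => h.
    by rewrite -(pmulr_rgt0 _ (ltr0Sn R (p + 1).+1)) wallis_sinSS mulr_gt0.
- move=> p; have := IHq q (ltnW nq) p => h.
  by rewrite -(pmulr_rgt0 _ (ltr0Sn R (p + q).+1)) wallis_cosSS mulr_gt0.
Qed.

Lemma wallis1 p : p.+1%:R * wallis p 1 = 1.
Proof.
elim: {p}p.+1 {-2}p (ltnSn p) => // m IH [|[|p]] mp.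
- by rewrite wallis01 mulr1.
- by rewrite wallis11 divff// pnatr_eq0.
- by rewrite -[p.+3]addn1 -[(p.+2 + 1)%N]/((p + 1).+2) wallis_sinSS IH// ltnW.
Qed.

Lemma wallisM p q :
  wallis p q.+1 * wallis p q = 2 * wallis p 0 * wallis p.*2.+1 q.*2.+1.
Proof.
elim: q => [|q IH].
  have h := wallis1 p; have h2 := wallis1 p.*2.+1.
  have n0 : p.+1%:R != 0 :> R by rewrite pnatr_eq0.
  apply: (mulfI n0).
  transitivity (wallis p 0); first by rewrite mulrA h mul1r.
  transitivity (wallis p 0 * (p.*2.+2%:R * wallis p.*2.+1 1)); first by rewrite h2 mulr1.
  by rewrite (_ : p.*2.+2%:R = 2 * p.+1%:R) -?natrM -?muln2 ?mulSn 1?mulnC//; ring.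
have n0 : (p + q).+2%:R != 0 :> R by rewrite pnatr_eq0.
apply: (mulfI n0); rewrite mulrA wallis_cosSS.
have := wallis_cosSS p.*2.+1 q.*2.+1.
have -> : (p.*2.+1 + q.*2.+1).+2%:R = 2 * (p + q).+2%:R :> R.
  by rewrite -natrM; congr _%:R; lia.
have -> : q.*2.+2%:R = 2 * q.+1%:R :> R by rewrite -natrM; congr _%:R; lia.
rewrite doubleS => E.
have E' : (p + q).+2%:R * wallis p.*2.+1 q.*2.+3 = q.+1%:R * wallis p.*2.+1 q.*2.+1.
  by apply: (@mulfI _ 2); rewrite ?pnatr_eq0// !mulrA.
transitivity (q.+1%:R * (wallis p q.+1 * wallis p q)); first by ring.
by rewrite IH [RHS]mulrCA E'; ring.
Qed.

End WallisIntegrals.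

Section WallisGini.
Variable R : realType.
Notation leb := (@lebesgue_measure R).

Lemma sin_ge0_le (x y : R) : 0 <= x -> x <= y -> y <= pi / 2 -> sin x ^+ 2 <= sin y ^+ 2.
Proof.
move=> x0 xy ypi.
have itv z : 0 <= z <= pi / 2 -> z \in `[(- (pi / 2)), (pi / 2)].
  move=> /andP[z0 z1]; rewrite in_itv /= z1 andbT (le_trans _ z0)//.
  by rewrite oppr_le0 pi2_ge0.
have s0 z : 0 <= z <= pi / 2 -> 0 <= sin z.
  move=> /andP[z0 z1]; apply: sin_ge0_pi; rewrite z0 (le_trans z1)//.
  by rewrite ler_pdivrMr// ler_peMr ?pi_ge0// ler1n.
have x01 : 0 <= x <= pi / 2 by rewrite x0 (le_trans xy).
have y01 : 0 <= y <= pi / 2 by rewrite ypi (le_trans x0).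
rewrite ler_pXn2r// ?nnegrE ?s0//.
move: xy; rewrite le_eqVlt => /predU1P[->//|xy]; apply/ltW.
by rewrite ltr_sin// itv.
Qed.

Lemma Rintegral_itv_split (f : R -> R) a x b : a <= x <= b -> continuous f ->
  \int[leb]_(t in `[a, b]) f t = \int[leb]_(t in `[a, x]) f t + \int[leb]_(t in `[x, b]) f t.
Proof.
move=> /andP[ax xb] cf.
have := @Rintegral_itvB R f (BLeft a) (BRight b) x.
rewrite Rintegral_itv_obnd_cbnd.
  by move=> <-; rewrite ?bnd_simp// ?subrKC// ?addrC ?subrK//; exact: continuous_itv_integrable.
apply: integrableS (continuous_itv_integrable a b cf) => //.
by apply: subset_itvr; rewrite bnd_simp.
Qed.

(* The mean difference of two independent copies of [sin^2], whose density is
   [sin^p cos^q]: with [P' = w] and [G' = w sin^2], splitting the inner integral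
   at [x] removes the absolute value. *)
Lemma wallis_gini p q (gini := fun x => \int[leb]_(y in `[0, (pi / 2)])
     (`|sin y ^+ 2 - sin x ^+ 2| * (sin y ^+ p * cos y ^+ q))
     * (sin x ^+ p * cos x ^+ q)) :
  leb.-integrable `[0, (pi / 2)] (EFin \o gini) /\
  \int[leb]_(x in `[0, (pi / 2)]) gini x
  = 4 * wallis R p.*2.+1 q.*2.+1 / (p + q).+2%:R.
Proof.
set w : R -> R := fun x => sin x ^+ p * cos x ^+ q.
set K : R -> R := fun x => sin x ^+ p.+1 * cos x ^+ q.+1.
set N : R := (p + q).+2%:R.
have N0 : N != 0 by rewrite pnatr_eq0.
have cw : continuous w by exact: continuous_wallis.
have cs : continuous (fun x : R => sin x ^+ 2).
  by move=> x; have := @continuous_wallis R 2 0 x; under eq_fun do rewrite expr0 mulr1.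
have [P [P0 dP]] := continuous_primitive cw.
have [V [V0 dV]] := continuous_primitive (@continuous_wallis R p.*2.+1 q.*2.+1).
set e : R := pi / 2; have e0 : 0 <= e by exact: pi2_ge0.
have Pe : wallis R p q = P e.
  rewrite /wallis (@FTC2_is_derive _ _ P) ?P0 ?subr0//; first exact: continuous_subspaceT.
  by move=> x /andP[x0 _]; exact: dP.
have Ve : wallis R p.*2.+1 q.*2.+1 = V e.
  rewrite /wallis (@FTC2_is_derive _ _ V) ?V0 ?subr0//; first exact/continuous_subspaceT/continuous_wallis.
  by move=> x /andP[x0 _]; exact: dV.
have dK (x : R) : is_derive x 1 K (w x * (p.+1%:R - N * sin x ^+ 2)) by exact: is_derive_wallis.
have Ke : K e = 0 by rewrite /K cos_pihalf !exprS !mul0r mulr0.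
have K0 : K 0 = 0 by rewrite /K sin0 !exprS !mul0r.
pose G x := N^-1 * (p.+1%:R * P x - K x).
have dG (x : R) : 0 <= x -> is_derive x 1 G (w x * sin x ^+ 2).
  move=> x0; have := is_deriveZ N^-1 (is_deriveB (is_deriveZ p.+1%:R (dP x x0)) (dK x)).
  by move=> h; apply: is_derive_eq h _; rewrite /GRing.scale /=; field.
have inner (x : R) : 0 <= x <= e ->
    \int[leb]_(y in `[0, e]) (`|sin y ^+ 2 - sin x ^+ 2| * w y)
    = 2 * (sin x ^+ 2 * P x - G x) + (G e - sin x ^+ 2 * P e).
  move=> /andP[x0 xe]; set S := sin x ^+ 2.
  rewrite (@Rintegral_itv_split _ _ x); last 2 first.
  - by rewrite x0.
  - move=> y; apply: cvgM; last exact: cw.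
    by apply: cvg_norm; apply: cvgB; [exact: cs|exact: cvg_cst].
  have cT c : continuous (fun y => (sin y ^+ 2 - c) * w y).
    by move=> y; apply: cvgM; [apply: cvgB; [exact: cs|exact: cvg_cst]|exact: cw].
  have dH (y : R) : 0 <= y -> is_derive y 1 (fun y => G y - S * P y) ((sin y ^+ 2 - S) * w y).
    move=> y0; have h := is_deriveB (dG y y0) (is_deriveZ S (dP y y0)).
    by apply: is_derive_eq h _; rewrite /GRing.scale /=; ring.
  have -> : \int[leb]_(y in `[x, e]) (`|sin y ^+ 2 - S| * w y)
      = (G e - S * P e) - (G x - S * P x).
    rewrite -(FTC2_is_derive (f := fun y => (sin y ^+ 2 - S) * w y) (F := fun y => G y - S * P y) xe); last 2 first.
    - exact: continuous_subspaceT.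
    - by move=> y /andP[xy _]; apply: dH; exact: le_trans xy.
    - apply: eq_Rintegral => y /set_mem; rewrite /= in_itv /= => /andP[xy ye].
      by rewrite ger0_norm// subr_ge0 sin_ge0_le.
  have -> : \int[leb]_(y in `[0, x]) (`|sin y ^+ 2 - S| * w y)
      = - ((G x - S * P x) - (G 0 - S * P 0)).
    transitivity (\int[leb]_(y in `[0, x]) (-1 * ((sin y ^+ 2 - S) * w y))).
      apply: eq_Rintegral => y /set_mem; rewrite /= in_itv /= => /andP[y0 yx].
      rewrite ler0_norm ?mulN1r ?mulNr// subr_le0 sin_ge0_le//.
    rewrite RintegralZl//; last exact: continuous_itv_integrable.
    rewrite mulN1r (FTC2_is_derive (F := fun y => G y - S * P y) x0); first by [].
    - exact: continuous_subspaceT.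
    - by move=> y /andP[y0 _]; exact: dH.
  have G0 : G 0 = 0 by rewrite /G K0 P0 mulr0 subr0 mulr0.
  by rewrite G0 P0; ring.
pose g x := (2 * (sin x ^+ 2 * P x - G x) + (G e - sin x ^+ 2 * P e)) * w x.
have hg x : x \in `[0, e]%classic -> gini x = g x.
  by move=> /set_mem; rewrite /= in_itv /= => xe; rewrite /gini inner.
have cg : {within `[0, e], continuous g}.
  apply: continuous_in_subspaceT => x; rewrite inE /= in_itv /= => /andP[x0 _].
  have cd (F : R -> R) (l : R) : is_derive x 1 F l -> {for x, continuous F}.
    by move=> [dFx _]; apply/differentiable_continuous/derivable1_diffP.
  apply: cvgM; last exact: cw.
  apply: cvgD.
    apply: cvgM; first exact: cvg_cst.
    by apply: cvgB; [apply: cvgM; [exact: cs|exact: cd _ _ (dP x x0)]|exact: cd _ _ (dG x x0)].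
  apply: cvgB; first exact: cvg_cst.
  by apply: cvgM; [exact: cs|exact: cvg_cst].
split.
  apply: eq_integrable (continuous_compact_integrable (@segment_compact _ _ _) cg) => //.
  by move=> x xe; rewrite /= hg.
transitivity (\int[leb]_(x in `[0, e]) g x); first exact: eq_Rintegral.
pose Q (x : R) := 2 * (P x * G x) - N^-1 * (2 * p.+1%:R * (P x * P x) - 4 * V x)
   + (G e * P x - P e * G x).
have dQ (x : R) : 0 <= x -> is_derive x 1 Q (g x).
  move=> x0; have dP' := dP x x0; have dG' := dG x x0; have dV' := dV x x0.
  have h1 := is_deriveZ 2 (is_deriveM dP' dG').
  have h2 := is_deriveB (is_deriveZ (2 * p.+1%:R) (is_deriveM dP' dP')) (is_deriveZ 4 dV').
  have h3 := is_deriveB (is_deriveZ (G e) dP') (is_deriveZ (P e) dG').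
  have h := is_deriveD (is_deriveB h1 (is_deriveZ N^-1 h2)) h3.
  apply: is_derive_eq h _; rewrite /GRing.scale /= /g /G /K.
  have -> : sin x ^+ p.*2.+1 * cos x ^+ q.*2.+1
      = (sin x ^+ p.+1 * cos x ^+ q.+1) * w x.
    by rewrite /w -!addnn !exprS !exprD; ring.
  by field.
rewrite (FTC2_is_derive (F := Q) e0 cg); last by move=> x /andP[x0 _]; exact: dQ.
rewrite /Q /G Ke K0 P0 V0 Ve; field => //.
Qed.
End WallisGini.

(** * Gamma at half-integers *)

Section GammaHalf.
Variable R : realType.
Notation leb := (@lebesgue_measure R).

Let a N : R := N.+1%:R^-1.
Let b N : R := N.+1%:R.

Let a0 N : 0 < a N. Proof. by rewrite invr_gt0. Qed.
Let b1 N : 1 <= b N. Proof. by rewrite ler1n. Qed.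
Let a1 N : a N <= 1. Proof. by rewrite invf_le1// b1. Qed.
Let b0 N : 0 < b N. Proof. exact: lt_le_trans (b1 N). Qed.

Let exhaust k : \bigcup_N `[a N ^+ k.+1, b N ^+ k.+1]%classic = `]0, +oo[%classic.
Proof.
apply/seteqP; split => [x [N _]|x]; rewrite /= !in_itv /=.
  by move=> /andP[+ _]; rewrite andbT; apply: lt_le_trans; rewrite exprn_gt0.
rewrite andbT => x0.
pose N := maxn (Num.bound x) (Num.bound x^-1).
have xN : x <= b N.
  rewrite (le_trans (ltW (archi_boundP (ltW x0))))// ler_nat.
  by rewrite (leq_trans (leq_maxl _ _) (leqnSn _)).
have xN' : x^-1 <= b N.
  have xi : 0 <= x^-1 by rewrite invr_ge0 ltW.
  rewrite (le_trans (ltW (archi_boundP xi)))// ler_nat.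
  by rewrite (leq_trans (leq_maxr _ _) (leqnSn _)).
exists N => //=; rewrite in_itv /=; apply/andP; split.
  rewrite exprS (@le_trans _ _ (a N))//.
    by apply: ler_piMr (ltW (a0 N)) _; exact: exprn_ile1 (ltW (a0 N)) (a1 N).
  by rewrite -[x]invrK /a lef_pV2 ?posrE ?invr_gt0.
by rewrite (le_trans xN)// exprS; apply: ler_peMr (ltW (b0 N)) _; exact: exprn_ege1.
Qed.

Let exhaust_nd k : nondecreasing_seq (fun N => `[a N ^+ k.+1, b N ^+ k.+1]%classic).
Proof.
move=> M N MN; rewrite subsetEset; apply: subset_itvScc; rewrite bnd_simp.
  by rewrite ler_pXn2r ?nnegrE ?(ltW (a0 _))// /a lef_pV2 ?posrE// ler_nat.
by rewrite ler_pXn2r ?nnegrE ?(ltW (b0 _))// ler_nat.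
Qed.

Let exhaust_cvg k (f : R -> R) : measurable_fun [set` `]0, +oo[%R : interval R] f ->
  (forall x, 0 < x -> 0 <= f x) ->
  (\int[leb]_(x in [set` `[a N ^+ k.+1, b N ^+ k.+1]%R]) (f x)%:E)%E @[N --> \oo] -->
  (\int[leb]_(x in `]0%R, +oo[) (f x)%:E)%E.
Proof.
move=> mf f0; rewrite -(exhaust k); apply: ge0_nondecreasing_set_cvg_integral => //.
- move=> N; apply/measurable_EFinP; apply: measurable_funS mf => //.
  by move=> x xN; rewrite -(exhaust k); exists N.
- move=> N x /= xN; rewrite lee_fin f0//.
  have : (\bigcup_N `[a N ^+ k.+1, b N ^+ k.+1]%classic) x by exists N.
  by rewrite (exhaust k) /= in_itv /= andbT.
Qed.

Let h n (u : R) : R := u ^+ n * expR (- u ^+ 2).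

Let ch n : continuous (h n).
Proof.
move=> x; apply: cvgM; first exact: exprn_continuous.
apply: (@cvg_comp _ _ _ (fun u : R => - u ^+ 2) expR); last exact: continuous_expR.
by apply: cvgN; exact: exprn_continuous.
Qed.

Let J n N := \int[leb]_(u in `[a N, b N]) h n u.

Let EFinJ n N : (\int[leb]_(u in [set` `[a N, b N]%R]) (h n u)%:E)%E = (J n N)%:E.
Proof.
rewrite /J /Rintegral fineK//; apply: integrable_fin_num => //.
exact: continuous_itv_integrable.
Qed.

Let dh n (x : R) : is_derive x 1 (h n.+1) (n.+1%:R * h n x - 2 * h n.+2 x).
Proof.
have d1 := is_deriveX n.+1 (is_derive_id x (1 : R)).
have d2 := is_deriveN (is_deriveX 2 (is_derive_id x (1 : R))).
have d3 := is_derive1_comp (is_derive_expR _) d2.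
have d := is_deriveM d1 d3.
rewrite (_ : h n.+1 = id ^+ n.+1 * (expR \o - id ^+ 2) :> (R -> R)); last first.
  by apply/funext => y; rewrite /h /= !exprfctE.
apply: is_derive_eq d _; rewrite /GRing.scale /= !opprfctE !exprfctE /h /= !exprS.
by ring.
Qed.

Let JSS n N :
  J n.+2 N = (n.+1%:R * J n N - (h n.+1 (b N) - h n.+1 (a N))) / 2.
Proof.
have ab : a N <= b N by exact: le_trans (a1 N) (b1 N).
have E : \int[leb]_(x in `[a N, b N]) (n.+1%:R * h n x - 2 * h n.+2 x)
    = h n.+1 (b N) - h n.+1 (a N).
  rewrite (@FTC2_is_derive _ _ (h n.+1))//.
  apply: continuous_subspaceT => x.
  by apply: cvgB; (apply: cvgM; first exact: cvg_cst); exact: ch.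
rewrite -E RintegralB//; try (apply: continuous_itv_integrable => x;
  apply: cvgM; [exact: cvg_cst|exact: ch]).
rewrite !RintegralZl//; try exact: continuous_itv_integrable.
by rewrite opprB addrC subrK mulrC mulKf.
Qed.

Let a_cvg : a @ \oo --> (0 : R). Proof. exact: cvg_harmonic. Qed.

Let ha_cvg n : h n.+1 (a N) @[N --> \oo] --> (0 : R).
Proof.
rewrite (_ : 0 = h n.+1 0); last by rewrite /h exprS !mul0r.
exact: (cvg_comp _ _ a_cvg (@ch n.+1 0)).
Qed.

Let hb_le n N : h n.+1 (b N) <= n.+1`!%:R * a N.
Proof.
have B := b0 N; have B1 := b1 N.
have B2 : 0 <= b N ^+ 2 by rewrite exprn_ge0// ltW.
have E := expR_ge1Dxn n B2.
have F0 : (0 : R) < n.+1`!%:R by rewrite ltr0n fact_gt0.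
rewrite /h expRN ler_pdivrMr ?expR_gt0//.
apply: (@le_trans _ _ (n.+1`!%:R * a N * ((b N ^+ 2) ^+ n.+1 / n.+1`!%:R))); last first.
  rewrite ler_wpM2l//; first by rewrite mulr_ge0// ltW.
  by apply: le_trans E; rewrite lerDr.
rewrite -exprM mul2n -addnn exprD {2}exprS.
rewrite [leRHS](_ : _ = b N ^+ n.+1 * b N ^+ n).
  by rewrite ler_peMr ?exprn_ege1// exprn_ge0// ltW.
by rewrite /a -/(b N); field; rewrite !gt_eqF.
Qed.

Let hb_cvg n : h n.+1 (b N) @[N --> \oo] --> (0 : R).
Proof.
apply: (@squeeze_cvgr _ _ _ _ (fun=> 0) (fun N => n.+1`!%:R * a N)).
- apply: nearW => N; rewrite hb_le andbT mulr_ge0 ?expR_ge0// exprn_ge0// ltW//.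
- exact: cvg_cst.
- by rewrite -[X in _ --> X](mulr0 n.+1`!%:R); apply: cvgM; [exact: cvg_cst|].
Qed.

Fixpoint gauss_moment n : R :=
  match n with
  | 0 => Num.sqrt pi / 2
  | 1 => 2^-1
  | n'.+2 => n'.+1%:R * gauss_moment n' / 2
  end.

Lemma gauss_momentSS n : gauss_moment n.+2 = n.+1%:R * gauss_moment n / 2.
Proof. by []. Qed.

Let J_cvg n : J n @ \oo --> gauss_moment n.
Proof.
elim: {n}n.+1 {-2}n (ltnSn n) => // m IH [|[|n]] nm /=.
- have hm : measurable_fun [set` `]0, +oo[%R : interval R] (h 0).
    by apply: measurable_funTS; exact: continuous_measurable_fun.
  have h0 x : 0 < x -> 0 <= h 0 x by move=> _; rewrite /h expr0 mul1r expR_ge0.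
  have := @exhaust_cvg 0 _ hm h0; under eq_fun do rewrite !expr1 EFinJ.
  rewrite integral_itv_obnd_cbnd; last exact/measurable_EFinP.
  under eq_integral do rewrite /h expr0 mul1r.
  by rewrite integral0y_gauss => /fine_cvg.
- have E N : J 1 N = (h 0 (a N) - a N * h 1 (b N)) / 2.
    rewrite /J (@FTC2_is_derive _ _ (fun x => - 2^-1 * h 0 x)).
    + have bN : N.+1%:R != 0 :> R by rewrite pnatr_eq0.
      by rewrite /h !expr0 !expr1 /a /b; field; rewrite addrC natr1.
    + exact: le_trans (a1 N) (b1 N).
    + exact: continuous_subspaceT.
    + move=> x _.
      have d2 := is_deriveN (is_deriveX 2 (is_derive_id x (1 : R))).
      have d3 := is_derive1_comp (is_derive_expR _) d2.
      rewrite (_ : expR \o _ = h 0) in d3; last first.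
        by apply/funext => y; rewrite /h /= !exprfctE expr0 mul1r.
      have d := is_deriveZ (- 2^-1) d3.
      suff <- : - 2^-1 *: (expR ((- id ^+ 2) x) * - (2 * x ^+ 2.-1)%:A) = h 1 x by exact: d.
      by rewrite /GRing.scale /= !opprfctE !exprfctE /h /= !expr1; field.
  rewrite (eq_cvg _ _ E).
  have L : (h 0 (a N) - a N * h 1 (b N)) / 2 @[N --> \oo] --> (h 0 0 - 0 * 0) / 2.
    apply: cvgM; last exact: cvg_cst.
    apply: cvgB; first exact: (cvg_comp _ _ a_cvg (@ch 0 0)).
    by apply: cvgM; [exact: a_cvg|exact: hb_cvg].
  by move: L; rewrite {3}/h expr0 expr0n /= oppr0 expR0 mulr0 subr0 !mul1r.
- rewrite (eq_cvg _ _ (JSS n)).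
  have L : (n.+1%:R * J n N - (h n.+1 (b N) - h n.+1 (a N))) / 2 @[N --> \oo] -->
      (n.+1%:R * gauss_moment n - (0 - 0)) / 2.
    apply: cvgM; last exact: cvg_cst.
    apply: cvgB; last by apply: cvgB; [exact: hb_cvg|exact: ha_cvg].
    by apply: cvgM; [exact: cvg_cst|apply: IH; exact: ltnW].
  by move: L; rewrite !subr0.
Qed.

Lemma GammaE n : Gamma (n.+1%:R / 2 : R) = 2 * gauss_moment n.
Proof.
pose G (t : R) : R := t `^ (n.+1%:R / 2 - 1) * expR (- t).
have mG : measurable_fun [set` `]0, +oo[%R : interval R] G.
  apply: measurable_funTS; apply: measurable_funM; first exact: measurable_powR.
  by apply: measurableT_comp => //; apply: measurableT_comp.
have G0 x : 0 < x -> 0 <= G x by rewrite mulr_ge0 ?powR_ge0 ?expR_ge0.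
have cG (x : R) : 0 < x -> {for x, continuous G}.
  move=> x0; apply: cvgM.
    pose g (y : R) := expR ((n.+1%:R / 2 - 1) * ln y).
    have cg : {for x, continuous g}.
      apply: (@cvg_comp _ _ _ (fun y : R => (n.+1%:R / 2 - 1) * ln y) expR);
        last exact: continuous_expR.
      by apply: cvgM; [exact: cvg_cst|exact: continuous_ln].
    rewrite {2}/powR gt_eqF// -/(g x).
    apply: cvg_trans cg; apply: near_eq_cvg; near=> z.
    by rewrite /powR gt_eqF//; near: z; exact: lt_nbhsr.
  apply: (@cvg_comp _ _ _ (fun u : R => - u) expR); last exact: continuous_expR.
  by apply: cvgN; exact: cvg_id.
have H := @exhaust_cvg 1 _ mG G0.
have E N : (\int[leb]_(x in [set` `[a N ^+ 2, b N ^+ 2]%R]) (G x)%:E)%E = (2 * J n N)%:E.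
  have dF (x : R) : is_derive x 1 (fun u : R => u ^+ 2) (2 * x).
    have d := is_deriveX 2 (is_derive_id x (1 : R)).
    rewrite (_ : (fun _ => _) = id ^+ 2 :> (R -> R)); last first.
      by apply/funext => y; rewrite !exprfctE.
    by apply: is_derive_eq d _; rewrite /GRing.scale /= expr1 mulr1.
  have F' : (fun u : R => u ^+ 2)^`()%classic = (fun x => 2 * x).
    by apply/funext => x; rewrite derive1E; have [_ ->] := dF x.
  have c2 : continuous (fun x : R => 2 * x).
    by move=> x; apply: cvgM; [exact: cvg_cst|exact: cvg_id].
  have cF : continuous (fun u : R => u ^+ 2) by exact: exprn_continuous.
  have pow (x : R) : 0 < x -> (x ^+ 2) `^ (n.+1%:R / 2 - 1) * x = x ^+ n.
    move=> x0; rewrite -powR_mulrn ?ltW// -powRrM -[X in _ * X]powRr1 ?ltW//.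
    rewrite -powRD; last by rewrite (gt_eqF x0) implybT.
    by rewrite -[RHS]powR_mulrn ?ltW// -natr1; congr (_ `^ _); field.
  rewrite (@integration_by_substitution_increasing R (fun u => u ^+ 2) G (a N) (b N)).
  - rewrite F' EFinM -EFinJ -ge0_integralZl_EFin//.
    + apply: eq_integral => x /set_mem; rewrite /= in_itv /= => /andP[ax _].
      have x0 : 0 < x by exact: lt_le_trans ax.
      rewrite -EFinM; congr EFin; rewrite /G /h /= -(pow x x0) !fctE /=.
      by ring.
    + move=> x /=; rewrite in_itv /= => /andP[ax _].
      by rewrite lee_fin mulr_ge0 ?expR_ge0// exprn_ge0// ltW// (lt_le_trans _ ax).
    + apply/measurable_EFinP; apply: measurable_funTS.
      exact: continuous_measurable_fun.
  - exact: le_trans (a1 N) (b1 N).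
  - move=> x y; rewrite !in_itv /= => /andP[ax _] /andP[ay _] xy.
    by rewrite ltr_pXn2r// nnegrE ltW// (lt_le_trans (a0 N)).
  - by move=> x _; rewrite F'; exact: c2.
  - rewrite F'; apply/cvg_ex; exists (2 * a N); apply: cvg_at_right_filter; exact: c2.
  - rewrite F'; apply/cvg_ex; exists (2 * b N); apply: cvg_at_left_filter; exact: c2.
  - split.
    + by move=> x _; have [] := dF x.
    + by apply: cvg_at_right_filter; exact: cF.
    + by apply: cvg_at_left_filter; exact: cF.
  - apply: continuous_in_subspaceT => x; rewrite inE /= in_itv /= => /andP[ax _].
    by apply: cG; apply: lt_le_trans ax; rewrite exprn_gt0.
have H2 : (2 * J n N)%:E @[N --> \oo] --> (2 * gauss_moment n)%:E.
  apply: cvg_EFin; first exact: nearW.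
  by apply: cvgM; [exact: cvg_cst|exact: J_cvg].
rewrite /Gamma /Rintegral.
move: H; rewrite (eq_cvg _ _ E) => H.
by have /= -> := cvg_unique _ H H2.
Unshelve. all: by end_near.
Qed.

Lemma gauss_moment_gt0 n : 0 < gauss_moment n.
Proof.
elim: {n}n.+1 {-2}n (ltnSn n) => // m IH [|[|n]] nm /=.
- by rewrite divr_gt0// sqrtr_gt0 pi_gt0.
- by rewrite invr_gt0.
- by rewrite divr_gt0// mulr_gt0// IH// ltnW.
Qed.

Lemma wallis_Gamma p :
  2 * wallis R p 0 = Num.sqrt pi * (Gamma (p.+1%:R / 2 : R) / Gamma (p.+2%:R / 2)).
Proof.
rewrite !GammaE.
elim: {p}p.+1 {-2}p (ltnSn p) => // m IH [|[|p]] pm.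
- rewrite wallis00 /= -[in LHS](sqr_sqrtr (pi_ge0 R)).
  by field.
- rewrite wallis10 /=; have : Num.sqrt pi != 0 :> R by rewrite gt_eqF// sqrtr_gt0 pi_gt0.
  by move=> s0; field.
- have E : 2 * wallis R p.+2 0 = p.+1%:R / p.+2%:R * (2 * wallis R p 0).
    have n0 : p.+2%:R != 0 :> R by rewrite pnatr_eq0.
    have E := wallis_sinSS R p 0; rewrite addn0 in E.
    apply: (mulfI n0); rewrite mulrCA E.
    by move: n0; move: (p.+2%:R) => x x0; field.
  rewrite E (IH p (ltnW pm)) !gauss_momentSS.
  have g0 : gauss_moment p.+1 != 0 by rewrite gt_eqF// gauss_moment_gt0.
  have n0 : p.+2%:R != 0 :> R by rewrite pnatr_eq0.
  move: n0 g0; move: (p.+2%:R) (gauss_moment p.+1) => n g n0 g0.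
  by field; rewrite g0 n0.
Qed.
End GammaHalf.

(** * From the moments of cos^2 (theta / 2) to gamma *)

Section RintegralSum.
Context d (T : measurableType d) (R : realType).
Variable m : {measure set T -> \bar R}.
Variables (D : set T) (mD : measurable D).

Lemma Rintegral_sum (I : Type) (r : seq I) (f : I -> T -> R) :
  (forall i, m.-integrable D (EFin \o f i)) ->
  \int[m]_(x in D) (\sum_(i <- r) f i x) = \sum_(i <- r) \int[m]_(x in D) f i x.
Proof.
move=> fi.
have si r' : m.-integrable D (EFin \o (fun x => \sum_(i <- r') f i x)).
  rewrite (_ : _ \o _ = (fun x => \sum_(i <- r') (f i x)%:E)%E).
    by apply: integrable_sum => // i _; exact: fi.
  by apply/funext => x; rewrite /= sumEFin.
elim: r => [|i r IH].
  rewrite big_nil; under eq_Rintegral do rewrite big_nil.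
  by rewrite Rintegral_cst// mul0r.
rewrite big_cons -IH -RintegralD//.
by apply: eq_Rintegral => x _; rewrite big_cons.
Qed.

End RintegralSum.

Section MomentMethod.
Context d (T : measurableType d) (R : realType).
Notation leb := (@lebesgue_measure R).
Variables (mu : probability T R) (p q : nat) (u : T -> R).
Hypotheses (mu_u : measurable_fun setT u) (u01 : forall x, 0 <= u x <= 1).
Hypothesis moments : forall k,
  \int[mu]_x (u x ^+ k) = wallis R (p + k.*2) q / wallis R p q.

Let w (r : R) := sin r ^+ p * cos r ^+ q.
Let e : R := pi / 2.

Let cw : continuous w. Proof. exact: continuous_wallis. Qed.

Let csin2 : continuous (fun r : R => sin r ^+ 2).
Proof.
move=> x; have := @continuous_wallis R 2 0 x.
by under eq_fun do rewrite expr0 mulr1.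
Qed.

Let mcomp (f : R -> R) : continuous f -> measurable_fun setT (f \o u).
Proof. by move=> cf; apply: measurableT_comp => //; exact: continuous_measurable_fun. Qed.

Let ucomp_integrable (f : R -> R) M : continuous f ->
  (forall x, 0 <= x <= 1 -> `|f x| <= M) -> mu.-integrable setT (EFin \o (f \o u)).
Proof.
move=> cf fM; apply: (@bounded_integrable _ _ _ mu setT _ M) => //; first exact: mcomp.
by move=> x _; exact: fM.
Qed.

Let normX01 (x : R) k : 0 <= x <= 1 -> `|x ^+ k| <= 1.
Proof. by move=> /andP[x0 x1]; rewrite normrX exprn_ile1// ger0_norm. Qed.

Lemma poly_moments (P : {poly R}) :
  \int[mu]_x P.[u x]
  = (wallis R p q)^-1 * \int[leb]_(r in `[0, e]) (P.[sin r ^+ 2] * w r).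
Proof.
under eq_Rintegral do rewrite horner_coef.
under [X in _ = _ * X]eq_Rintegral do rewrite horner_coef big_distrl /=.
rewrite Rintegral_sum//; last first.
  move=> j; apply: (ucomp_integrable (f := fun x => P`_j * x ^+ j) (M := `|P`_j|)).
    by move=> x; apply: cvgM; [exact: cvg_cst|exact: exprn_continuous].
  by move=> x x01; rewrite normrM ler_piMr// normX01.
have cX (k : nat) : continuous (fun r => (sin r ^+ 2) ^+ k * w r).
  move=> r; apply: cvgM; last exact: cw.
  exact: (@cvg_comp _ _ _ _ (fun x => x ^+ k) _ _ _ (@csin2 r) (@exprn_continuous _ k _)).
rewrite Rintegral_sum//; last first.
  move=> i; apply: continuous_itv_integrable => r.
  under eq_fun do rewrite -mulrA.
  by apply: cvgM; [exact: cvg_cst|exact: cX].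
rewrite mulr_sumr; apply: eq_bigr => i _.
rewrite RintegralZl//; last first.
  apply: (ucomp_integrable (f := fun x => x ^+ i) (M := 1)).
    exact: exprn_continuous.
  by move=> x x01; exact: normX01.
rewrite moments.
have E1 : \int[leb]_(r in `[0, e]) (P`_i * (sin r ^+ 2) ^+ i * w r)
    = P`_i * \int[leb]_(r in `[0, e]) ((sin r ^+ 2) ^+ i * w r).
  rewrite -RintegralZl//; last exact: continuous_itv_integrable.
  by apply: eq_Rintegral => r _; rewrite mulrA.
rewrite {}E1.
have -> : \int[leb]_(r in `[0, e]) ((sin r ^+ 2) ^+ i * w r) = wallis R (p + i.*2) q.
  by apply: eq_Rintegral => r _; rewrite /w -exprM mul2n mulrA -exprD addnC.
by ring.
Qed.

Lemma sqrt_poly_moments (P : {poly R}) :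
  (forall x, 0 <= x <= 1 -> 0 <= P.[x] <= 1) ->
  \int[mu]_x Num.sqrt P.[u x]
  = (wallis R p q)^-1 * \int[leb]_(r in `[0, e]) (Num.sqrt P.[sin r ^+ 2] * w r).
Proof.
move=> P01; set L := LHS; set I := \int[leb]_(r in _) _.
have W0 : 0 < wallis R p q by exact: wallis_gt0.
have cP : continuous (horner P) by exact: continuous_horner.
have csP : continuous (fun x => Num.sqrt P.[x]).
  move=> x; exact: (@cvg_comp _ _ _ (horner P) Num.sqrt _ _ _ (cP x) (@sqrt_continuous R _)).
have s01 (r : R) : 0 <= sin r ^+ 2 <= 1.
  by rewrite sqr_ge0 -(cos2Dsin2 r) lerDr sqr_ge0.
have close n : `|L - (wallis R p q)^-1 * I| <= 4 / n.+1%:R.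
  pose Q := sqrt_poly R n.+1 \Po P.
  have cQ : continuous (horner Q) by exact: continuous_horner.
  have PQ x : 0 <= x <= 1 -> `|Num.sqrt P.[x] - Q.[x]| <= 2 / n.+1%:R.
    by move=> x01; rewrite horner_comp sqrt_poly_approx// P01.
  have csub : continuous (fun x => Num.sqrt P.[x] - Q.[x]).
    by move=> x; apply: cvgB; [exact: csP|exact: cQ].
  have e2 : 0 <= 2 / n.+1%:R :> R by rewrite divr_ge0.
  have h1 : `|L - \int[mu]_x Q.[u x]| <= 2 / n.+1%:R.
    have iP : mu.-integrable setT (EFin \o (fun x => Num.sqrt P.[u x])).
      apply: (ucomp_integrable (f := fun x => Num.sqrt P.[x]) (M := 1)) => //.
      by move=> x /P01 /andP[p0 p1]; rewrite ger0_norm ?sqrtr_ge0// -sqrtr1 ler_sqrt.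
    have iQ : mu.-integrable setT (EFin \o (fun x => Q.[u x])).
      apply: (ucomp_integrable (f := horner Q) (M := 1 + 2 / n.+1%:R)) => //.
      move=> x x01; have /andP[p0 p1] := P01 _ x01; have := PQ _ x01.
      have : Num.sqrt P.[x] <= 1 by rewrite -sqrtr1 ler_sqrt.
      have := sqrtr_ge0 P.[x].
      set a := Num.sqrt _ => a0 a1; rewrite ler_distl ler_norml => /andP[h1 h2].
      move: (2 / n.+1%:R) h1 h2 e2 => ee h1 h2 e2. by apply/andP; split; lra.
    rewrite /L -RintegralB//.
    have := @normr_Rintegral_le _ T R mu setT (fun x => Num.sqrt P.[u x] - Q.[u x])
      (2 / n.+1%:R) measurableT (mcomp csub) (fun x _ => PQ _ (u01 x)).
    rewrite (_ : fine _ = 1) ?mulr1//.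
    by rewrite -[RHS]/(fine 1%E); congr fine; exact: probability_setT.
  have h2 : `|(wallis R p q)^-1 * I - \int[mu]_x Q.[u x]| <= 2 / n.+1%:R.
    rewrite poly_moments -mulrBr normrM gtr0_norm ?invr_gt0// ler_pdivrMl//.
    have cf (f : R -> R) : continuous f -> continuous (fun r => f (sin r ^+ 2) * w r).
      by move=> cf r; apply: cvgM; [exact: (@cvg_comp _ _ _ _ f _ _ _ (@csin2 r) (cf _))|exact: cw].
    have w0 r : r \in `[0, e]%classic -> 0 <= w r.
      rewrite inE /= in_itv /= => /andP[r0 re]; rewrite mulr_ge0// exprn_ge0//.
        apply: sin_ge0_pi; rewrite r0 (le_trans re)//.
        by rewrite ler_pdivrMr// ler_peMr ?pi_ge0// ler1n.
      apply: cos_ge0_pihalf; rewrite re andbT (le_trans _ r0)//.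
      by rewrite oppr_le0 pi2_ge0.
    rewrite -RintegralB//; last 2 first.
    - by apply: continuous_itv_integrable; exact: (cf _ csP).
    - by apply: continuous_itv_integrable; exact: (cf _ cQ).
    have cd := cf _ csub.
    apply: (@le_trans _ _ (\int[leb]_(r in `[0, e]) (2 / n.+1%:R * w r))); last first.
      rewrite RintegralZl; [|exact: measurable_itv|exact: continuous_itv_integrable].
      by rewrite [leRHS]mulrC -/(wallis R p q) lexx.
    have E (r : R) : Num.sqrt P.[sin r ^+ 2] * w r - Q.[sin r ^+ 2] * w r
        = (Num.sqrt P.[sin r ^+ 2] - Q.[sin r ^+ 2]) * w r by rewrite mulrBl.
    under eq_Rintegral do rewrite E.
    apply: le_trans (le_normr_Rintegral _ _) _ => //.
      exact: continuous_itv_integrable.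
    apply: le_Rintegral => //.
    + by apply: continuous_itv_integrable => r; apply: cvg_norm; exact: cd.
    + by apply: continuous_itv_integrable => r; apply: cvgM; [exact: cvg_cst|exact: cw].
    + move=> r rI; rewrite normrM (ger0_norm (w0 _ _)) ?inE//.
      by rewrite ler_wpM2r ?w0 ?inE// PQ.
  move: h1 h2; set A := \int[mu]_x Q.[u x]; set B := _^-1 * I => h1 h2.
  have -> : L - B = (L - A) - (B - A) by rewrite opprB addrA subrK.
  apply: le_trans (ler_normB _ _) _; apply: le_trans (lerD h1 h2) _.
  by rewrite -mulrDl -natrD.
apply/eqP; rewrite -subr_eq0 -normr_le0; apply/ler_addgt0Pl => x x0; rewrite addr0.
have x4 : 0 <= 4 / x by rewrite divr_ge0// ltW.
apply: (le_trans (close (Num.bound (4 / x)))).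
rewrite ler_pdivrMr// mulrC -ler_pdivrMr//.
by rewrite (le_trans (ltW (archi_boundP x4)))// ler_nat.
Qed.

End MomentMethod.

Section RankOneGamma.
Variables (R : realType) (T : pointedType) (theta : T -> T -> R).
Variables (mu : probability (borel theta) R) (s : T -> T -> R) (p q : nat).
Notation leb := (@lebesgue_measure R).
Hypotheses (s01 : forall x y, 0 <= s x y <= 1) (sC : forall x y, s x y = s y x).
Hypothesis ms : measurable_fun [set: borel theta * borel theta]
  (fun z : borel theta * borel theta => s z.1 z.2).
Hypotheses (theta_itv : forall x y, 0 <= theta x y <= pi)
  (cos_theta : forall x y, cos (theta x y) = 2 * s x y - 1).
Hypothesis moments : forall y k,
  \int[mu]_x (s x y ^+ k) = wallis R (p + k.*2) q / wallis R p q.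

Let w (r : R) := sin r ^+ p * cos r ^+ q.
Let e : R := pi / 2.

Let cw : continuous w. Proof. exact: continuous_wallis. Qed.

Let csin2 : continuous (fun r : R => sin r ^+ 2).
Proof.
move=> x; have := @continuous_wallis R 2 0 x.
by under eq_fun do rewrite expr0 mulr1.
Qed.

Let msl y : measurable_fun [set: borel theta] (fun x : borel theta => s x y).
Proof. by have := measurableT_comp ms (@pair2_measurable _ _ (borel theta) (borel theta) y). Qed.

Let msr x : measurable_fun [set: borel theta] (fun y : borel theta => s x y).
Proof. by under eq_fun do rewrite sC; exact: msl. Qed.

Let muT : mu setT = 1%E. Proof. exact: probability_setT. Qed.

Let Ecst (c : R) : \int[mu]_x c = c.
Proof.
rewrite Rintegral_cst// (_ : fine _ = 1) ?mulr1//.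
by rewrite -[RHS]/(fine 1%E); congr fine; exact: muT.
Qed.

Let sin2_01 (r : R) : 0 <= sin r ^+ 2 <= 1.
Proof. by rewrite sqr_ge0 -(cos2Dsin2 r) lerDr sqr_ge0. Qed.

Lemma chordalE x y : chordal theta x y = Num.sqrt (1 - s x y).
Proof.
have /andP[t0 t1] := theta_itv x y; rewrite /chordal.
have h0 : 0 <= sin (theta x y / 2).
  apply: sin_ge0_pi; rewrite divr_ge0//=.
  by rewrite ler_pdivrMr// (le_trans t1)// ler_peMr ?pi_ge0// ler1n.
rewrite -[LHS](ger0_norm h0) -sqrtr_sqr; congr Num.sqrt.
have := cos_theta x y; rewrite -{1}[theta x y](@divfK _ 2)// mulr_natr cos_mulr2n.
have := cos2Dsin2 (theta x y / 2); set S := sin _; set C := cos _.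
by rewrite -mulr_natr; lra.
Qed.

Lemma mean_chordal : mean mu (chordal theta) = wallis R p q.+1 / wallis R p q.
Proof.
have inner x : \int[mu]_y Num.sqrt (1 - s x y) = wallis R p q.+1 / wallis R p q.
  under eq_Rintegral do rewrite sC.
  have := @sqrt_poly_moments _ _ _ mu p q (fun y => s y x) (msl x)
     (fun y => s01 y x) (moments x) (1 - 'X).
  have E (t : R) : (1 - 'X).[t] = 1 - t :> R by rewrite !hornerE.
  under eq_Rintegral do rewrite E.
  move=> ->; last by move=> t t01; rewrite E; lra.
  rewrite mulrC; congr (_ / _); apply: eq_Rintegral => r /set_mem.
  rewrite /= in_itv /= => /andP[r0 re].
  have c0 : 0 <= cos r.
    by apply: cos_ge0_pihalf; rewrite re andbT (le_trans _ r0)// oppr_le0 pi2_ge0.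
  rewrite E -(cos2Dsin2 r) addrK sqrtr_sqr ger0_norm// exprS.
  by rewrite mulrCA.
rewrite /mean.
under eq_Rintegral do rewrite chordalE.
rewrite (@Rintegral_prod _ _ _ _ _ mu mu _ 1); last 3 first.
- have cf : continuous (fun t : R => Num.sqrt (1 - t)).
    move=> t; apply: (@cvg_comp _ _ _ (fun t => 1 - t) Num.sqrt); last exact: sqrt_continuous.
    by apply: cvgB; [exact: cvg_cst|exact: cvg_id].
  by apply: (measurableT_comp (continuous_measurable_fun cf) ms).
- move=> z; have /andP[z0 z1] := s01 z.1 z.2.
  by rewrite ger0_norm ?sqrtr_ge0// -[leRHS]sqrtr1 ler_sqrt//; lra.
- by apply: (le_lt_trans (_ : _ <= 1)%E); rewrite ?ltry// -muT.
under eq_Rintegral do rewrite inner.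
exact: Ecst.
Qed.

Let in_ball r x y : 0 <= r <= pi -> (theta x y < r) = (cos r < 2 * s x y - 1).
Proof.
move=> rpi; rewrite -cos_theta ltr_cos//.
- by rewrite in_itv /= theta_itv.
Qed.

Let half (y : T) : set (borel theta * R) := [set z | cos z.2 < 2 * s z.1 y - 1].

Let mhalf y : measurable (half y).
Proof.
have -> : half y = [set z | 0 < 2 * s z.1 y - 1 - cos z.2].
  by apply/seteqP; split => z; rewrite /half /= subr_gt0.
have mf : measurable_fun [set: borel theta * R] (fun z : borel theta * R => 2 * s z.1 y - 1 - cos z.2).
  apply: measurable_funB.
    apply: measurable_funB => //; apply: measurable_funM => //.
    by apply: measurableT_comp (msl y) _.
  by apply: measurableT_comp => //; apply: continuous_measurable_fun; exact: continuous_cos.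
have := mf measurableT `]0, +oo[%classic (measurable_itv _).
rewrite setTI; congr measurable.
by apply/seteqP; split => z; rewrite /= in_itv /= andbT.
Qed.

Let integral_sin_layer a b : 0 <= a <= pi -> 0 <= b <= pi ->
  \int[leb]_(r in `[0, pi]) (\1_[set r | (a < r) != (b < r)] r * sin r)
  = `|cos a - cos b|.
Proof.
wlog ab : a b / a <= b.
  move=> H a0 b0; have [ab|/ltW ba] := leP a b; first exact: H.
  rewrite distrC -H//; congr Rintegral; apply/funext => r; congr (_ * _).
  by congr (\1_ _ r); apply/seteqP; split => z /=; rewrite eq_sym.
move=> /andP[a0 ap] /andP[b0 bp].
rewrite ger0_norm; last by rewrite subr_ge0 leNgt ltr_cos ?in_itv /= ?a0 ?b0// -leNgt.
have -> : \int[leb]_(r in `[0, pi]) (\1_[set r | (a < r) != (b < r)] r * sin r)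
    = \int[leb]_(r in `]a, b]) sin r.
  rewrite [LHS]Rintegral_mkcond [RHS]Rintegral_mkcond; congr Rintegral.
  apply/funext => r; rewrite !patchE !mem_setE indicE.
  have -> : (r \in [set r | (a < r) != (b < r)]) = ((a < r) != (b < r)).
    by apply/idP/idP => [/set_mem|/mem_set].
  rewrite !in_itv /= [r <= b]leNgt.
  have [rb|rb] := ltP b r; have [ra|ra] := ltP a r => /=; rewrite ?mul1r ?mul0r ?if_same//.
    by rewrite ltNge (le_trans ra ab) in rb.
  by rewrite (le_trans a0 (ltW ra)) (le_trans rb bp).
rewrite Rintegral_itv_obnd_cbnd; last first.
  apply: integrableS (continuous_itv_integrable a b _) => //.
    by apply: subset_itvr; rewrite bnd_simp.
  exact: continuous_sin.
rewrite (@FTC2_is_derive _ _ (fun x => - cos x))//.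
- by rewrite opprK addrC.
- by apply: continuous_subspaceT; exact: continuous_sin.
- by move=> x _; rewrite -[sin x]opprK; exact: is_deriveN.
Qed.

Lemma theta_deltaE y1 y2 :
  theta_delta mu sin y1 y2 = \int[mu]_x `|s x y1 - s x y2|.
Proof.
pose f (z : borel theta * R) := \1_(half y1 `+` half y2) z * sin z.2.
have mh : measurable (half y1 `+` half y2) by apply: measurableU; exact: measurableD.
have mf : measurable_fun [set: borel theta * R] f.
  apply: measurable_funM; first exact: measurable_indic.
  by apply: measurableT_comp => //; apply: continuous_measurable_fun; exact: continuous_sin.
have f1 z : `|f z| <= 1.
  rewrite normrM -[leRHS]mulr1 ler_pM//.
    by rewrite indicE; case: (_ \in _); rewrite ?normr1 ?normr0.
  by rewrite ler_norml sin_geN1 sin_le1.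
rewrite /theta_delta.
transitivity (2^-1 * \int[leb]_(r in `[0, pi]) \int[mu]_x f (x, r)).
  congr (_ * _); apply: eq_Rintegral => r /set_mem; rewrite /= in_itv /= => rpi.
  have -> : oball theta y1 r `+` oball theta y2 r
      = [set x : borel theta | (half y1 `+` half y2) (x, r)].
    by apply/funext => x; rewrite /oball /half /setY /setD /setU /= !in_ball.
  have mr : measurable [set x : borel theta | (half y1 `+` half y2) (x, r)].
    have := @pair2_measurable _ _ (borel theta) R r measurableT _ mh.
    by rewrite setTI.
  have bi : mu.-integrable setT
      (EFin \o (\1_[set x : borel theta | (half y1 `+` half y2) (x, r)] : borel theta -> R)).
    exact: (integrable_indic mu).
  transitivity (\int[mu]_x (\1_[set x : borel theta | (half y1 `+` half y2) (x, r)] x * sin r)).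
    rewrite RintegralZr//; congr (_ * _).
    rewrite /Rintegral (integral_indic mu measurableT mr) setIT//.
  apply: eq_Rintegral => x _; rewrite /f !indicE /=; congr (_%:R * _).
rewrite -(@Rfubini _ _ _ _ _ mu leb f 1)//; last by rewrite /= lebesgue_measure_itv /= lte_fin pi_gt0 -EFinB ltry.
have inner x : \int[leb]_(r in `[0, pi]) f (x, r) = 2 * `|s x y1 - s x y2|.
  transitivity (\int[leb]_(r in `[0, pi])
     (\1_[set r | (theta x y1 < r) != (theta x y2 < r)] r * sin r)).
    apply: eq_Rintegral => r /set_mem; rewrite /= in_itv /= => rpi.
    rewrite /f !indicE /=.
    have -> : ((x, r) \in half y1 `+` half y2) = ((theta x y1 < r) != (theta x y2 < r)).
      apply/idP/idP => [/set_mem|].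
        rewrite /half /setY /setD /setU /= -!in_ball//.
        by move=> [[-> /negP/negbTE ->]|[-> /negP/negbTE ->]].
      move=> h; apply/mem_set; move: h; rewrite /half /setY /setD /setU /= -!in_ball//.
      by case: (_ < _); case: (_ < _) => // _; [left|right].
    have -> : (r \in [set r | (theta x y1 < r) != (theta x y2 < r)])
        = ((theta x y1 < r) != (theta x y2 < r)).
      by apply/idP/idP => [/set_mem|/mem_set].
    by [].
  rewrite integral_sin_layer// !cos_theta (_ : _ - _ = 2 * (s x y1 - s x y2)); last by ring.
  by rewrite normrM ger0_norm.
under eq_Rintegral do rewrite inner.
rewrite RintegralZl ?mulKf//.
apply: (@bounded_integrable _ _ _ mu setT (fun x => `|s x y1 - s x y2|) 1) => //.
  by apply: measurableT_comp => //; apply: measurable_funB; exact: msl.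
move=> x _; have := s01 x y1; have := s01 x y2.
by rewrite normr_id ler_norml; lra.
Qed.

Lemma mean_theta_delta : mean mu (theta_delta mu sin)
  = 4 * wallis R p.*2.+1 q.*2.+1 / ((p + q).+2%:R * wallis R p q ^+ 2).
Proof.
have W0 : wallis R p q != 0 by rewrite gt_eqF// wallis_gt0.
have inner (a : R) y : 0 <= a <= 1 -> \int[mu]_x `|s x y - a|
    = (wallis R p q)^-1 * \int[leb]_(r in `[0, e]) (`|sin r ^+ 2 - a| * w r).
  move=> /andP[a0 a1].
  have := @sqrt_poly_moments _ _ _ mu p q (fun x => s x y) (msl y)
     (fun x => s01 x y) (moments y) (('X - a%:P) ^+ 2).
  have E (t : R) : (('X - a%:P) ^+ 2).[t] = (t - a) ^+ 2 by rewrite !hornerE.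
  under eq_Rintegral do rewrite E sqrtr_sqr.
  move=> ->.
    by congr (_ * _); apply: eq_Rintegral => r _; rewrite E sqrtr_sqr.
  by move=> t /andP[t0 t1]; rewrite E sqr_ge0 /= expr2; nra.
have dist_le1 (a b : R) : 0 <= a <= 1 -> 0 <= b <= 1 -> `|a - b| <= 1.
  by move=> /andP[? ?] /andP[? ?]; rewrite ler_norml; apply/andP; split; lra.
have dist_integrable x (a : R) : 0 <= a <= 1 ->
    mu.-integrable setT (EFin \o (fun y => `|a - s y x|)).
  move=> a01; apply: (@bounded_integrable _ _ _ mu setT (fun y => `|a - s y x|) 1) => //.
    by apply: measurableT_comp => //; apply: measurable_funB => //; exact: msl.
  by move=> y _; rewrite normr_id dist_le1.
pose c := 4 * wallis R p.*2.+1 q.*2.+1 / (p + q).+2%:R.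
have layer x : mu.-integrable setT
      (EFin \o (fun y => \int[leb]_(r in `[0, e]) (`|sin r ^+ 2 - s y x| * w r))) /\
    \int[mu]_y \int[leb]_(r in `[0, e]) (`|sin r ^+ 2 - s y x| * w r)
    = (wallis R p q)^-1 * c.
  pose g (z : borel theta * R) := `|sin z.2 ^+ 2 - s z.1 x| * w z.2.
  have mg : measurable_fun [set: borel theta * R] g.
    apply: measurable_funM; last exact: measurableT_comp (continuous_measurable_fun cw) measurable_snd.
    apply: measurableT_comp => //; apply: measurable_funB.
      exact: measurableT_comp (continuous_measurable_fun csin2) measurable_snd.
    exact: measurableT_comp (msl x) measurable_fst.
  have g1 z : `|g z| <= 1.
    rewrite normrM -[leRHS]mulr1 ler_pM//.
      have := s01 z.1 x; have := sin2_01 z.2.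
      by rewrite normr_id ler_norml => /andP[? ?] /andP[? ?]; apply/andP; split; lra.
    rewrite normrM -[leRHS]mulr1 ler_pM// normrX exprn_ile1// ler_norml.
      by rewrite sin_geN1 sin_le1.
    by rewrite cos_geN1 cos_le1.
  have ey : (leb [set` `[0, e]%R] < +oo)%E.
    have e0 : 0 < e by rewrite divr_gt0// pi_gt0.
    by rewrite /= lebesgue_measure_itv /= lte_fin e0 -EFinB ltry.
  split; first exact: (@Rintegral_section_integrable _ _ _ _ _ mu leb g 1).
  rewrite (@Rfubini _ _ _ _ _ mu leb g 1)//.
  transitivity (\int[leb]_(r in `[0, e]) ((wallis R p q)^-1 *
     (\int[leb]_(r' in `[0, e]) (`|sin r' ^+ 2 - sin r ^+ 2| * w r') * w r))).
    apply: eq_Rintegral => r _; rewrite /g /= RintegralZr//; last exact: dist_integrable.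
    under eq_Rintegral do rewrite distrC.
    by rewrite inner// -[LHS]mulrA.
  have [gi E] := wallis_gini R p q.
  by rewrite RintegralZl// E.
have outer x : \int[(mu \x mu)%E]_z `|s x z.1 - s x z.2| = (wallis R p q)^-1 * ((wallis R p q)^-1 * c).
  rewrite (@Rintegral_prod _ _ _ _ _ mu mu _ 1)//; last first.
  - by apply: (le_lt_trans (_ : _ <= 1)%E); rewrite ?ltry// -muT.
  - by move=> z; rewrite normr_id dist_le1.
  - apply: measurableT_comp => //.
    by apply: measurable_funB; [exact: measurableT_comp (msr x) measurable_fst
      |exact: measurableT_comp (msr x) measurable_snd].
  have [li <-] := layer x; rewrite -RintegralZl//.
  apply: eq_Rintegral => y _; rewrite -(inner (s y x) x)//.
  by apply: eq_Rintegral => y' _; rewrite distrC sC [s x y]sC.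
rewrite /mean.
pose mu2 := product_subprobability (mu : subprobability _ _, mu : subprobability _ _).
transitivity (\int[mu]_x \int[(mu \x mu)%E]_z `|s x z.1 - s x z.2|).
  rewrite (@Rfubini _ _ _ _ _ mu mu2
    (fun z : borel theta * (borel theta * borel theta) => `|s z.1 z.2.1 - s z.1 z.2.2|) 1)//.
  - by apply: eq_Rintegral => z _; rewrite theta_deltaE.
  - apply: measurableT_comp => //; apply: measurable_funB.
      exact: (measurableT_comp ms (measurable_fun_pair measurable_fst
        (measurableT_comp measurable_fst measurable_snd))).
    exact: (measurableT_comp ms (measurable_fun_pair measurable_fst
      (measurableT_comp measurable_snd measurable_snd))).
  - by move=> z; rewrite normr_id dist_le1.
  - by apply: (le_lt_trans (_ : _ <= 1)%E); rewrite ?ltry// sprobability_setT.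
under eq_Rintegral do rewrite outer.
have n0 : (p + q).+2%:R != 0 :> R by rewrite pnatr_eq0.
by rewrite Ecst /c; move: n0; move: (p + q).+2%:R => n n0; field; rewrite W0 n0.
Qed.

Theorem gamma_of_moments : gamma mu = Num.sqrt pi / 4 * (p + q).+2%:R *
  (Gamma (p.+1%:R / 2) / Gamma (p.+2%:R / 2)).
Proof.
rewrite /gamma mean_chordal mean_theta_delta.
have := wallisM R p q; have := wallis_Gamma R p.
have Wg := wallis_gt0 R p.*2.+1 q.*2.+1; have W0 := wallis_gt0 R p q.
move=> E1 E2.
transitivity ((p + q).+2%:R * (wallis R p q.+1 * wallis R p q) / (4 * wallis R p.*2.+1 q.*2.+1)).
  have n0 : (p + q).+2%:R != 0 :> R by rewrite pnatr_eq0.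
  by move: n0; move: (p + q).+2%:R => n n0; field; rewrite n0 !gt_eqF.
rewrite E2 E1; move: (Gamma _ / Gamma _) => x.
by have W1 := negbT (gt_eqF Wg); field; rewrite W1.
Qed.
End RankOneGamma.

(** * Moments from curves *)

Section PolyAux.
Variable R : realType.

Lemma horner_inj (P Q : {poly R}) : (forall z, P.[z] = Q.[z]) -> P = Q.
Proof.
move=> PQ; apply/eqP; rewrite -subr_eq0; apply/eqP.
pose rs := [seq (i%:R : R) | i <- iota 0 (size (P - Q)).+1].
have rs_uniq : uniq rs.
  by rewrite map_inj_uniq ?iota_uniq// => m n /eqP; rewrite eqr_nat => /eqP.
apply: (roots_geq_poly_eq0 (rs := rs)) => //; last by rewrite size_map size_iota.
by apply/allP => z _; rewrite rootE hornerD hornerN PQ subrr.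
Qed.

Definition quad (a b c : R) : {poly R} := a%:P + b%:P * 'X + c%:P * 'X^2.

Lemma horner_quad a b c z : (quad a b c).[z] = a + b * z + c * z ^+ 2.
Proof. by rewrite /quad !hornerE. Qed.

Lemma coef_quad a b c i : (quad a b c)`_i =
  match i with 0 => a | 1 => b | 2 => c | _ => 0 end.
Proof.
rewrite /quad !coefD !coefCM coefC coefX coefXn.
by case: i => [|[|[|i]]] /=; rewrite ?mulr0 ?mulr1 ?addr0 ?add0r.
Qed.

Lemma size_quad_exp a b c k : (size (quad a b c ^+ k) <= k.*2.+1)%N.
Proof.
have h : (size (quad a b c) <= 3)%N.
  by apply/leq_sizeP => -[|[|[|j]]] // _; rewrite coef_quad.
apply: leq_trans (size_poly_exp_leq _ _) _; rewrite ltnS -mul2n leq_mul2r.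
by apply/orP; right; case: (size _) h.
Qed.

Lemma coef_quad_exp a b c k :
  [/\ (quad a b c ^+ k)`_0 = a ^+ k, (quad a b c ^+ k)`_1 = k%:R * b * a ^+ k.-1
    & (quad a b c ^+ k)`_2 = k%:R * c * a ^+ k.-1
        + (k * k.-1)%:R / 2 * b ^+ 2 * a ^+ k.-2].
Proof.
elim: k => [|k [IH0 IH1 IH2]].
  by rewrite !expr0 !coefC /= !mul0r addr0.
rewrite !exprS !coefM !big_ord_recl !big_ord0 /= !addr0 !coef_quad IH0 IH1 IH2 /=.
split => //.
  by case: k {IH0 IH1 IH2} => [|k]; rewrite /= ?exprS; ring.
by case: k {IH0 IH1 IH2} => [|[|k]]; rewrite /= ?exprS ?expr0 ?natrM; field.
Qed.

End PolyAux.

Section MomentRecursion.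
Context d (T : measurableType d) (R : realType) (mu : probability T R).

Definition tame (f : T -> R) :=
  measurable_fun setT f /\ exists M, forall x, `|f x| <= M.

Lemma tame_integrable f : tame f -> mu.-integrable setT (EFin \o f).
Proof. by move=> [mf [M fM]]; exact: (@bounded_integrable _ _ _ mu setT f M). Qed.

Lemma tame_cst c : tame (fun=> c).
Proof. by split => //; exists `|c|. Qed.

Lemma tameD f g : tame f -> tame g -> tame (fun x => f x + g x).
Proof.
move=> [mf [M fM]] [mg [N gN]]; split; first exact: measurable_funD.
by exists (M + N) => x; rewrite (le_trans (ler_normD _ _))// lerD.
Qed.

Lemma tameM f g : tame f -> tame g -> tame (fun x => f x * g x).
Proof.
move=> [mf [M fM]] [mg [N gN]]; split; first exact: measurable_funM.
by exists (M * N) => x; rewrite normrM ler_pM.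
Qed.

Lemma tameX f k : tame f -> tame (fun x => f x ^+ k).
Proof.
move=> tf; elim: k => [|k IH]; first by under eq_fun do rewrite expr0; exact: tame_cst.
by under eq_fun do rewrite exprS; exact: tameM.
Qed.

Lemma tame_sum (I : Type) (r : seq I) (f : I -> T -> R) :
  (forall i, tame (f i)) -> tame (fun x => \sum_(i <- r) f i x).
Proof.
move=> tf; elim: r => [|i r IH].
  by under eq_fun do rewrite big_nil; exact: tame_cst.
by under eq_fun do rewrite big_cons; exact: tameD.
Qed.

Lemma tame_coef_exp (P : T -> {poly R}) k j :
  (forall i, tame (fun x => (P x)`_i)) -> tame (fun x => (P x ^+ k)`_j).
Proof.
move=> tP; elim: k j => [|k IH] j.
  by under eq_fun do rewrite expr0; exact: tame_cst.
by under eq_fun do rewrite exprS coefM; apply: tame_sum => i; exact: tameM.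
Qed.

(* Along the curve with parameter [z], [s] becomes [(s + 2 g z + a z^2) / (1 + z^2)];
   comparing the coefficients of [z^2] expresses that the second derivative of the
   (constant) moments vanishes. *)
Lemma curve_moment (s g a : T -> R) k : tame s -> tame g -> tame a ->
  (forall z, \int[mu]_x ((s x + 2 * g x * z + a x * z ^+ 2) ^+ k.+1)
    = (1 + z ^+ 2) ^+ k.+1 * \int[mu]_x (s x ^+ k.+1)) ->
  \int[mu]_x (a x * s x ^+ k + 2 * k%:R * g x ^+ 2 * s x ^+ k.-1)
    = \int[mu]_x (s x ^+ k.+1).
Proof.
move=> ts tg ta H; set C := RHS.
pose P x := quad (s x) (2 * g x) (a x).
have tP i : tame (fun x => (P x)`_i).
  rewrite /P; under eq_fun do rewrite coef_quad.
  case: i => [|[|[|i]]] //; last exact: tame_cst.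
  by apply: tameM => //; exact: tame_cst.
pose Q := \poly_(j < k.+1.*2.+1) \int[mu]_x (P x ^+ k.+1)`_j.
have tPk j := tame_coef_exp k.+1 j tP.
have QE : Q = C *: quad 1 0 1 ^+ k.+1.
  apply: horner_inj => z; rewrite hornerZ horner_exp horner_quad mul0r addr0 mul1r mulrC -H.
  transitivity (\int[mu]_x (P x ^+ k.+1).[z]).
    rewrite horner_poly.
    transitivity (\int[mu]_x (\sum_(j < k.+1.*2.+1) (P x ^+ k.+1)`_j * z ^+ j)).
      rewrite Rintegral_sum//; last first.
        by move=> j; apply: tame_integrable; apply: tameM => //; exact: tame_cst.
      by apply: eq_bigr => j _; rewrite RintegralZr//; exact: tame_integrable.
    apply: eq_Rintegral => x _; rewrite (@horner_coef_wide _ k.+1.*2.+1)//.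
    exact: size_quad_exp.
  by apply: eq_Rintegral => x _; rewrite horner_exp horner_quad.
have := congr1 (fun p : {poly R} => p`_2) QE.
rewrite /= coef_poly /= coefZ.
have [_ _ h2] := coef_quad_exp (1 : R) 0 1 k.+1. rewrite h2.
rewrite expr0n /= mulr0 mul0r addr0 !expr1n !mulr1 => E.
have k0 : k.+1%:R != 0 :> R by rewrite pnatr_eq0.
apply: (mulfI k0); rewrite [RHS]mulrC -E -RintegralZl//; last first.
  apply: tame_integrable; apply: tameD.
    by apply: tameM => //; exact: tameX.
  apply: tameM; last exact: tameX.
  by apply: tameM; [exact: tame_cst|exact: tameX].
apply: eq_Rintegral => x _.
have [_ _ ->] := coef_quad_exp (s x) (2 * g x) (a x) k.+1.
by rewrite /= natrM; field.
Qed.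

Lemma moments_of_curves (I : finType) (s : T -> R) (g a : I -> T -> R) (p q : nat) :
  tame s -> (forall i, tame (g i)) -> (forall i, tame (a i)) ->
  (forall i k z, \int[mu]_x ((s x + 2 * g i x * z + a i x * z ^+ 2) ^+ k)
    = (1 + z ^+ 2) ^+ k * \int[mu]_x (s x ^+ k)) ->
  (forall x, \sum_i a i x = p.+1%:R * (1 - s x)) ->
  (forall x, \sum_i g i x ^+ 2 = s x * (1 - s x)) ->
  #|I| = q.+1 ->
  forall k, \int[mu]_x (s x ^+ k) = wallis R (p + k.*2) q / wallis R p q.
Proof.
move=> ts tg ta H sa sg cI.
have W0 n : wallis R n q != 0 by rewrite gt_eqF// wallis_gt0.
elim=> [|k IH].
  rewrite addn0 divff//; under eq_Rintegral do rewrite expr0.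
  rewrite Rintegral_cst// mul1r.
  by rewrite -[RHS]/(fine 1%E); congr fine; exact: probability_setT.
set c := LHS.
have E : \int[mu]_x ((p.+1 + k.*2)%:R * (s x ^+ k - s x ^+ k.+1)) = q.+1%:R * c.
  transitivity (\sum_(i : I) \int[mu]_x
      (a i x * s x ^+ k + 2 * k%:R * g i x ^+ 2 * s x ^+ k.-1)).
    rewrite -Rintegral_sum//; last first.
      move=> i; apply: tame_integrable; apply: tameD.
        by apply: tameM => //; exact: tameX.
      apply: tameM; last exact: tameX.
      by apply: tameM; [exact: tame_cst|exact: tameX].
    apply: eq_Rintegral => x _; rewrite big_split /= -!mulr_suml -!mulr_sumr sa sg.
    rewrite natrD -mul2n natrM.
    by case: k {IH c} => [|k]; rewrite /= ?exprS; ring.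
  under eq_bigr do rewrite curve_moment//.
  by rewrite sumr_const cI mulr_natl.
move: E; rewrite RintegralZl//; last first.
  apply: tame_integrable; apply: tameD; first exact: tameX.
  by under eq_fun do rewrite -mulN1r; apply: tameM; [exact: tame_cst|exact: tameX].
rewrite RintegralB//; try exact/tame_integrable/tameX.
rewrite -/c IH => E.
have Wk := wallis_sinSS R (p + k.*2) q.
have {}E : (p + k.*2 + q).+2%:R * c = (p + k.*2).+1%:R * (wallis R (p + k.*2) q / wallis R p q).
  rewrite (_ : (p + k.*2 + q).+2 = (p.+1 + k.*2) + q.+1)%N; last by lia.
  by rewrite natrD mulrDl -E -addSn; ring.
rewrite doubleS !addnS; apply: (@mulfI _ (p + k.*2 + q).+2%:R); first by rewrite pnatr_eq0.
by rewrite E !mulrA Wk.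
Qed.

End MomentRecursion.

Section MetricBorel.
Variables (R : realType) (T : pointedType) (theta : T -> T -> R).

Lemma metric_open_measurable (A : set (borel theta)) :
  metric_open theta A -> measurable A.
Proof. by move=> oA; exact: sub_sigma_algebra. Qed.

Section Continuous.
Variable s : T -> T -> R.
Hypotheses (theta_itv : forall x y, 0 <= theta x y <= pi)
  (cos_theta : forall x y, cos (theta x y) = 2 * s x y - 1).

Lemma small_ball x (e : R) : 0 < e ->
  exists2 r, 0 < r & forall y, theta y x < r -> 1 - s y x < e.
Proof.
move=> e0; pose e1 := Num.min 1 e.
have e10 : 0 < e1 by rewrite lt_min ltr01 e0.
have e11 : e1 <= 1 by rewrite ge_min lexx.
have e1e : e1 <= e by rewrite ge_min lexx orbT.
have I1 : -1 <= 1 - e1 < 1 by apply/andP; split; lra.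
exists (acos (1 - e1)); first exact: acos_gt0.
move=> y yr.
have I2 : 1 - e1 \in `[(-1), 1] by rewrite in_itv /=; apply/andP; split; lra.
have : cos (acos (1 - e1)) < cos (theta y x).
  rewrite ltr_cos// in_itv /= ?theta_itv//.
  by move: I2; rewrite in_itv /= => I2; rewrite acos_ge0// acos_lepi.
by rewrite acosK// cos_theta; lra.
Qed.

Lemma measurable_theta_continuous (f : T -> R) (C : R) : 0 <= C ->
  (forall x y, (f x - f y) ^+ 2 <= C * (1 - s x y)) ->
  measurable_fun [set: borel theta] (f : borel theta -> R).
Proof.
move=> C0 fC; apply: (measurability _ (RGenOInfty.measurableE R)).
move=> _ [_ [a ->] <-]; rewrite setTI; apply: metric_open_measurable => x /=.
rewrite in_itv /= andbT => ax.
have d0 : 0 < (f x - a) ^+ 2 / (C + 1) by rewrite divr_gt0 ?exprn_gt0 ?subr_gt0// ltr_wpDl.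
have [r r0 H] := small_ball x d0; exists r => // y /H ys /=.
rewrite in_itv /= andbT.
have C1 : 0 < C + 1 by rewrite ltr_wpDl.
rewrite ltr_pdivlMr// in ys.
have := fC y x; rewrite ltNge; apply/contraTN => ya.
rewrite -ltNge.
have s0 : 0 <= (f y - f x) ^+ 2 by exact: sqr_ge0.
have : (f x - a) ^+ 2 <= (f y - f x) ^+ 2 by nra.
move: ax ya; nra.
Qed.

End Continuous.

Lemma isometry_measurable g : isometry theta g ->
  measurable_fun [set: borel theta] (g : borel theta -> borel theta).
Proof.
move=> [_ ig]; apply: (@measurability _ _ (borel theta) (borel theta) setT g (metric_open theta)) => // _ [A oA <-].
rewrite setTI; apply: metric_open_measurable => x /oA [r r0 rA].
by exists r => // y yx; apply: rA; rewrite /oball /= ig.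
Qed.

Variable mu : probability (borel theta) R.

Lemma isometry_integral g (f : borel theta -> R) : invariant_measure mu ->
  isometry theta g -> tame f ->
  \int[mu]_x f (g x) = \int[mu]_x f x.
Proof.
move=> inv ig tf.
have mg := isometry_measurable ig.
have [mf [M fM]] := tf.
rewrite /Rintegral; congr fine.
have fi := tame_integrable mu tf.
have tfg : tame (fun x : borel theta => f (g x)).
  by split; [exact: measurableT_comp mf mg|exists M => x; exact: fM].
have := @integral_pushforward _ _ (borel theta) (borel theta) R g mg mu setT (EFin \o f).
rewrite preimage_setT => <- //.
- apply: eq_measure_integral => A mA _.
  exact: (inv g ig A mA).
- exact/measurable_EFinP.
- exact: (tame_integrable mu tfg).
Qed.

Lemma homogeneous_moments (s : T -> T -> R) : invariant_measure mu ->
  (forall y, tame (fun x : borel theta => s x y)) ->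
  (forall g, isometry theta g -> forall x y, s (g x) (g y) = s x y) ->
  (forall y y', exists2 g, isometry theta g & g y = y') ->
  forall y y' k, \int[mu]_x (s x y ^+ k) = \int[mu]_x (s x y' ^+ k).
Proof.
move=> inv ts sg tr y y' k; have [g ig gy] := tr y y'.
rewrite -(@isometry_integral g (fun x => s x y' ^+ k))//; last exact: tameX.
by apply: eq_Rintegral => x _; rewrite -gy sg.
Qed.

Lemma homogeneous_curve_moments (s : T -> T -> R) (y0 : T) (I : finType)
    (g a : I -> T -> R) (c : I -> R -> T) (p q : nat) : invariant_measure mu ->
  (forall y, tame (fun x : borel theta => s x y)) ->
  (forall h, isometry theta h -> forall x y, s (h x) (h y) = s x y) ->
  (forall y y', exists2 h, isometry theta h & h y = y') ->
  (forall i, tame (g i : borel theta -> R)) -> (forall i, tame (a i : borel theta -> R)) ->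
  (forall i z x, (1 + z ^+ 2) * s x (c i z) = s x y0 + 2 * g i x * z + a i x * z ^+ 2) ->
  (forall x, \sum_i a i x = p.+1%:R * (1 - s x y0)) ->
  (forall x, \sum_i g i x ^+ 2 = s x y0 * (1 - s x y0)) ->
  #|I| = q.+1 ->
  forall y k, \int[mu]_x (s x y ^+ k) = wallis R (p + k.*2) q / wallis R p q.
Proof.
move=> inv ts sg tr tg ta curve sa sg2 cI y k.
rewrite (homogeneous_moments inv ts sg tr y y0).
move: k; apply: (@moments_of_curves _ (borel theta) R mu I (fun x => s x y0) g a) => //.
move=> i k z; rewrite -(homogeneous_moments inv ts sg tr (c i z) y0) -RintegralZl//.
  by apply: eq_Rintegral => x _; rewrite -curve exprMn.
exact: (tame_integrable mu (tameX k (ts (c i z)))).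
Qed.

End MetricBorel.

(** * Spheres *)

Section Dot.
Variable R : realType.

Lemma dotE n (x y : 'rV[R]_n) : dot x y = (x *m y^T) 0 0.
Proof. by rewrite /dot !mxE; apply: eq_bigr => i _; rewrite mxE. Qed.

Lemma dotC n (x y : 'rV[R]_n) : dot x y = dot y x.
Proof. by apply: eq_bigr => i _; rewrite mulrC. Qed.

Lemma dotDl n (x y z : 'rV[R]_n) : dot (x + y) z = dot x z + dot y z.
Proof. by rewrite !dotE mulmxDl mxE. Qed.

Lemma dotZl n a (x z : 'rV[R]_n) : dot (a *: x) z = a * dot x z.
Proof. by rewrite !dotE -scalemxAl mxE. Qed.

Lemma dotNl n (x z : 'rV[R]_n) : dot (- x) z = - dot x z.
Proof. by rewrite -scaleN1r dotZl mulN1r. Qed.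

Lemma dotDr n (x y z : 'rV[R]_n) : dot z (x + y) = dot z x + dot z y.
Proof. by rewrite !(dotC z) dotDl. Qed.

Lemma dotNr n (x z : 'rV[R]_n) : dot z (- x) = - dot z x.
Proof. by rewrite !(dotC z) dotNl. Qed.

Lemma dotZr n a (x z : 'rV[R]_n) : dot z (a *: x) = a * dot z x.
Proof. by rewrite !(dotC z) dotZl. Qed.

Lemma dot_delta n (x : 'rV[R]_n) j : dot x (delta_mx 0 j) = x 0 j.
Proof.
rewrite /dot (bigD1 j) //= big1 => [|i /negPf ij]; rewrite !mxE ?eqxx ?ij ?andbF ?mulr0//.
by rewrite mulr1 addr0.
Qed.

Lemma dot_ge0 n (x : 'rV[R]_n) : 0 <= dot x x.
Proof. by apply: sumr_ge0 => i _; rewrite -expr2 sqr_ge0. Qed.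

Lemma dot_eq0 n (x : 'rV[R]_n) : (dot x x == 0) = (x == 0).
Proof.
apply/eqP/eqP => [x0|->]; last by rewrite dotE mul0mx mxE.
apply/rowP => i; rewrite mxE; apply/eqP.
have /eqP := x0; rewrite psumr_eq0 => [|j _]; last by rewrite -expr2 sqr_ge0.
by move=> /allP /(_ i (mem_index_enum _)) /=; rewrite mulf_eq0 orbb.
Qed.

Lemma householder n (x y : 'rV[R]_n) : dot x x = dot y y ->
  exists O : 'M[R]_n, [/\ O^T = O, O *m O = 1%:M, x *m O = y
    & forall z : 'rV[R]_n, dot z x = dot z y -> z *m O = z].
Proof.
move=> xy; have [<-|nxy] := eqVneq x y.
  by exists 1%:M; split; rewrite ?trmx1 ?mulmx1// => z _; rewrite mulmx1.
pose w : 'rV[R]_n := x - y.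
pose c := dot w w.
have c0 : c != 0 by rewrite dot_eq0 subr_eq0.
pose O : 'M[R]_n := 1%:M - (2 / c) *: (w^T *m w).
have zO (z : 'rV[R]_n) : z *m O = z - (2 / c * dot z w) *: w.
  rewrite /O mulmxBr mulmx1 -scalemxAr mulmxA [z *m w^T]mx11_scalar -dotE.
  by rewrite mul_scalar_mx scalerA.
exists O; split.
- by rewrite linearB linearZ /= trmx1 trmx_mul trmxK.
- apply/row_matrixP => i; rewrite row_mul !rowE.
  set z := delta_mx 0 i; rewrite mulmx1 !zO.
  rewrite dotDl dotNl dotZl -/c -addrA -opprD -scalerDl.
  rewrite [X in X *: w](_ : _ = 0) ?scale0r ?subr0 ?mulmx1//.
  by field.
- rewrite zO (_ : _ * _ = 1) ?scale1r ?subKr//.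
  have : c = 2 * dot x w.
    by rewrite /c /w !dotDl !dotDr !dotNl !dotNr -xy (dotC y); ring.
  by move=> E; rewrite mulrAC -E divff.
- move=> z; rewrite zO => /eqP; rewrite -subr_eq0 -dotNr -dotDr => /eqP ->.
  by rewrite mulr0 scale0r subr0.
Qed.

End Dot.

Section SphereGamma.
Variables (R : realType) (d : nat).
Notation S := (sphere R d).

Let sphere_dot (x : S) : dot (val x) (val x) = 1.
Proof.
have /eqP := valP x; rewrite /euclid => /(congr1 (fun t => t ^+ 2)).
by rewrite sqr_sqrtr ?dot_ge0// expr1n.
Qed.

Let mkS (x : 'rV[R]_d.+1) (h : dot x x = 1) : S.
Proof. by exists x; rewrite /euclid h sqrtr1. Defined.

Let dot_dist (x y : S) :
  dot (val x - val y) (val x - val y) = 2 - 2 * dot (val x) (val y).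
Proof.
rewrite !dotDl !dotDr !dotNl !dotNr !sphere_dot (dotC (val y)); ring.
Qed.

Let dot_itv (x y : S) : -1 <= dot (val x) (val y) <= 1.
Proof.
have h1 := dot_ge0 (val x - val y); rewrite dot_dist in h1.
have h2 := dot_ge0 (val x + val y).
rewrite !dotDl !dotDr !sphere_dot (dotC (val y)) in h2.
by apply/andP; split; lra.
Qed.

Let s (x y : S) := (1 + dot (val x) (val y)) / 2.

Let s01 x y : 0 <= s x y <= 1.
Proof. by have /andP[? ?] := dot_itv x y; rewrite /s; apply/andP; split; lra. Qed.

Let sC x y : s x y = s y x. Proof. by rewrite /s dotC. Qed.

Let theta_itv (x y : S) : 0 <= sphere_dist x y <= pi.
Proof. by rewrite /sphere_dist acos_ge0// acos_lepi. Qed.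

Let cos_theta (x y : S) : cos (sphere_dist x y) = 2 * s x y - 1.
Proof.
rewrite /sphere_dist acosK; last by rewrite in_itv /= dot_itv.
by rewrite /s; lra.
Qed.

Let tame_coord j : tame (fun x : borel (@sphere_dist R d) => val (x : S) 0 j).
Proof.
have le j' (x : 'rV[R]_d.+1) : x 0 j' ^+ 2 <= dot x x.
  rewrite /dot (bigD1 j') //= -expr2 lerDl.
  by apply: sumr_ge0 => i _; rewrite -expr2 sqr_ge0.
split.
  apply: (measurable_theta_continuous theta_itv cos_theta (C := 4)) => // x y.
  apply: le_trans (_ : dot (val x - val y) (val x - val y) <= _).
    by have := le j (val x - val y); rewrite !mxE.
  by rewrite dot_dist /s; lra.
exists 1 => x; rewrite -[leRHS](sqrtr1) -sqrtr_sqr ler_sqrt//.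
by have := le j (val (x : S)); rewrite sphere_dot.
Qed.

Let tame_s (y : S) : tame (fun x : borel (@sphere_dist R d) => s x y).
Proof.
apply: tameM; last exact: tame_cst.
apply: tameD; first exact: tame_cst.
by apply: tame_sum => i; apply: tameM; [exact: tame_coord|exact: tame_cst].
Qed.

Let s_measurable : measurable_fun
  [set: borel (@sphere_dist R d) * borel (@sphere_dist R d)]
  (fun z : borel (@sphere_dist R d) * borel (@sphere_dist R d) => s z.1 z.2).
Proof.
apply: measurable_funM => //; apply: measurable_funD => //.
apply: measurable_sum => i; apply: measurable_funM.
  by have [m _] := tame_coord i; exact: measurableT_comp m measurable_fst.
by have [m _] := tame_coord i; exact: measurableT_comp m measurable_snd.
Qed.

Let s_isometry g : isometry (@sphere_dist R d) g ->
  forall x y, s (g x) (g y) = s x y.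
Proof.
move=> [_ ig] x y; have := cos_theta (g x) (g y); rewrite ig cos_theta; lra.
Qed.

Let transitive (x y : S) : exists2 g, isometry (@sphere_dist R d) g & g x = y.
Proof.
have [M [MT MM xM _]] := householder (etrans (sphere_dot x) (esym (sphere_dot y))).
have dotM (u v : 'rV[R]_d.+1) : dot (u *m M) (v *m M) = dot u v.
  by rewrite !dotE trmx_mul MT mulmxA -(mulmxA u) MM mulmx1.
pose g (u : S) : S := mkS (etrans (dotM (val u) (val u)) (sphere_dot u)).
have gK : involutive g.
  by move=> u; apply: val_inj; rewrite /= -mulmxA MM mulmx1.
exists g; last by apply: val_inj.
split; first by exists g.
by move=> u v; rewrite /sphere_dist /= dotM.
Qed.

Theorem sphere_gamma (mu : probability (borel (@sphere_dist R d)) R) : (0 < d)%N ->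
  invariant_measure mu ->
  gamma mu = Num.sqrt pi / 4 * (d + d)%:R * (Gamma (d%:R / 2) / Gamma ((d%:R + 1) / 2)).
Proof.
move=> d0 inv.
pose e0 : 'rV[R]_d.+1 := delta_mx 0 0.
pose y0 : S := mkS (etrans (dot_delta e0 0) (etrans (mxE _ _ _ _) erefl)).
pose cv (j : 'I_d) (z : R) : 'rV[R]_d.+1 :=
  (1 + z ^+ 2)^-1 *: ((1 - z ^+ 2) *: e0 + (2 * z) *: delta_mx 0 (lift 0 j)).
have z0 (z : R) : 1 + z ^+ 2 != 0 by rewrite gt_eqF// ltr_pwDl// sqr_ge0.
have cv1 j z : dot (cv j z) (cv j z) = 1.
  rewrite /cv dotZl dotZr !dotDl !dotDr !dotZl !dotZr !dot_delta !mxE /=.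
  by rewrite eqxx mulr1n; field.
pose c j z := mkS (cv1 j z).
have curve j z x : (1 + z ^+ 2) * s x (c j z)
    = s x y0 + 2 * (val x 0 (lift 0 j) / 2) * z + (1 - s x y0) * z ^+ 2.
  by rewrite /s /= /cv dotZr dotDr !dotZr !dot_delta; field.
have d1 : d.-1.+1 = d by rewrite prednK.
have H := @homogeneous_curve_moments R S (@sphere_dist R d) mu s y0 'I_d
  (fun j x => val x 0 (lift 0 j) / 2) (fun j x => 1 - s x y0) c d.-1 d.-1 inv tame_s
  s_isometry transitive _ _ curve.
have := @gamma_of_moments R S (@sphere_dist R d) mu s d.-1 d.-1 s01 sC s_measurable
  theta_itv cos_theta.
rewrite -addSn -addnS d1 -[d.+1%:R]natr1 => -> // y k; apply: H => //.
- by move=> j; apply: tameM; [exact: tame_coord|exact: tame_cst].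
- move=> j; apply: tameD; first exact: tame_cst.
  by under eq_fun do rewrite -mulN1r; apply: tameM; [exact: tame_cst|exact: tame_s].
- by move=> x; rewrite sumr_const card_ord d1 mulr_natl.
- move=> x; have := sphere_dot x; rewrite {1}/dot big_ord_recl /= => E.
  rewrite (eq_bigr (fun j => 4^-1 * (val x 0 (lift 0 j) * val x 0 (lift 0 j)))); last first.
    by move=> j _; field.
  rewrite -mulr_sumr /s /= dot_delta; move: E; set v := val x 0 0; set t := \sum_j _.
  by move=> /eqP; rewrite addrC eq_sym -subr_eq => /eqP <-; field.
- by rewrite card_ord.
Qed.
End SphereGamma.

(** * Cayley-Dickson algebras *)

Section CayleyDicksonAlgebra.
Variable R : realType.
Notation cd := (cd R).

Fixpoint cd_ip k : cd k -> cd k -> R :=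
  match k return cd k -> cd k -> R with
  | 0 => fun a b : R => a * b
  | k'.+1 => fun a b => cd_ip a.1 b.1 + cd_ip a.2 b.2
  end.

Fixpoint cd_scale k (r : R) : cd k -> cd k :=
  match k return cd k -> cd k with
  | 0 => fun a : R => r * a
  | k'.+1 => fun a => (cd_scale r a.1, cd_scale r a.2)
  end.

Lemma cd_ipC k (a b : cd k) : cd_ip a b = cd_ip b a.
Proof. by elim: k a b => [|k IH] a b /=; [rewrite mulrC|rewrite !(IH a.1) !(IH a.2)]. Qed.

Lemma cd_ipDl k (a b c : cd k) : cd_ip (a + b) c = cd_ip a c + cd_ip b c.
Proof.
by elim: k a b c => [|k IH] a b c /=; [rewrite mulrDl|rewrite !IH addrACA].
Qed.

Lemma cd_ipNl k (a c : cd k) : cd_ip (- a) c = - cd_ip a c.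
Proof. by elim: k a c => [|k IH] a c /=; [rewrite mulNr|rewrite !IH opprD]. Qed.

Lemma cd_ip0l k (c : cd k) : cd_ip 0 c = 0.
Proof. by elim: k c => [|k IH] c /=; [rewrite mul0r|rewrite !IH addr0]. Qed.

Lemma cd_ipZl k r (a c : cd k) : cd_ip (cd_scale r a) c = r * cd_ip a c.
Proof. by elim: k a c => [|k IH] a c /=; [rewrite mulrA|rewrite !IH mulrDr]. Qed.

Lemma cd_ipDr k (a b c : cd k) : cd_ip c (a + b) = cd_ip c a + cd_ip c b.
Proof. by rewrite !(cd_ipC c) cd_ipDl. Qed.

Lemma cd_ipNr k (a c : cd k) : cd_ip c (- a) = - cd_ip c a.
Proof. by rewrite !(cd_ipC c) cd_ipNl. Qed.

Lemma cd_ip0r k (c : cd k) : cd_ip c 0 = 0.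
Proof. by rewrite cd_ipC cd_ip0l. Qed.

Lemma cd_ipZr k r (a c : cd k) : cd_ip c (cd_scale r a) = r * cd_ip c a.
Proof. by rewrite !(cd_ipC c) cd_ipZl. Qed.

Lemma cd_ip_suml k (I : Type) (r : seq I) (F : I -> cd k) c :
  cd_ip (\sum_(i <- r) F i) c = \sum_(i <- r) cd_ip (F i) c.
Proof.
by elim: r => [|i r IH]; rewrite ?big_nil ?cd_ip0l// !big_cons cd_ipDl IH.
Qed.

Lemma cd_ip_sumr k (I : Type) (r : seq I) (F : I -> cd k) c :
  cd_ip c (\sum_(i <- r) F i) = \sum_(i <- r) cd_ip c (F i).
Proof. by rewrite cd_ipC cd_ip_suml; apply: eq_bigr => i _; rewrite cd_ipC. Qed.

Lemma cd_ip_ge0 k (a : cd k) : 0 <= cd_ip a a.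
Proof. by elim: k a => [|k IH] a /=; [rewrite -expr2 sqr_ge0|rewrite addr_ge0]. Qed.

Lemma cd_ip_eq0 k (a : cd k) : cd_ip a a = 0 -> a = 0.
Proof.
elim: k a => [|k IH] a /=; first by move=> /eqP; rewrite mulf_eq0 orbb => /eqP.
case: a => a b /= /eqP; rewrite paddr_eq0 ?cd_ip_ge0// => /andP[/eqP a0 /eqP b0].
by rewrite (IH _ a0) (IH _ b0).
Qed.

Lemma cd_ip_ext k (a b : cd k) : (forall c, cd_ip a c = cd_ip b c) -> a = b.
Proof.
move=> ab; apply/eqP; rewrite -subr_eq0; apply/eqP/cd_ip_eq0.
by rewrite cd_ipDl cd_ipNl ab subrr.
Qed.

Local Ltac abel := apply: cd_ip_ext => ?; rewrite ?(cd_ipDl, cd_ipNl, cd_ipZl, cd_ip0l); ring.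

Lemma cd_scaleA k r s (a : cd k) : cd_scale r (cd_scale s a) = cd_scale (r * s) a.
Proof. by abel. Qed.

Lemma cd_scale1 k (a : cd k) : cd_scale 1 a = a. Proof. by abel. Qed.

Lemma cd_scaleDr k r (a b : cd k) : cd_scale r (a + b) = cd_scale r a + cd_scale r b.
Proof. by abel. Qed.

Lemma cd_scaleDl k r s (a : cd k) : cd_scale (r + s) a = cd_scale r a + cd_scale s a.
Proof. by abel. Qed.

Lemma cd_scale0 k (a : cd k) : cd_scale 0 a = 0.
Proof. by apply: cd_ip_ext => c; rewrite cd_ipZl cd_ip0l mul0r. Qed.

Lemma cd_scaler0 k r : cd_scale r (0 : cd k) = 0.
Proof. by apply: cd_ip_ext => c; rewrite cd_ipZl cd_ip0l mulr0. Qed.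

Lemma cd_scaleN k r (a : cd k) : cd_scale r (- a) = - cd_scale r a.
Proof. by abel. Qed.

Lemma cd_scale_sumr k (I : Type) (s : seq I) (F : I -> cd k) r :
  cd_scale r (\sum_(i <- s) F i) = \sum_(i <- s) cd_scale r (F i).
Proof.
by elim: s => [|i s IH]; rewrite ?big_nil ?cd_scaler0// !big_cons cd_scaleDr IH.
Qed.

Lemma cd_scale_suml k (I : Type) (s : seq I) (F : I -> R) (a : cd k) :
  cd_scale (\sum_(i <- s) F i) a = \sum_(i <- s) cd_scale (F i) a.
Proof.
by elim: s => [|i s IH]; rewrite ?big_nil ?cd_scale0// !big_cons cd_scaleDl IH.
Qed.

Lemma cd_conjD k (a b : cd k) : cd_conj (a + b) = cd_conj a + cd_conj b.
Proof. by elim: k a b => [//|k IH] a b /=; rewrite IH opprD. Qed.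

Lemma cd_conjN k (a : cd k) : cd_conj (- a) = - cd_conj a.
Proof. by elim: k a => [//|k IH] a /=; rewrite IH. Qed.

Lemma cd_conjK k : involutive (@cd_conj R k).
Proof. by elim: k => [//|k IH] [a b] /=; rewrite IH opprK. Qed.

Lemma cd_conjZ k r (a : cd k) : cd_conj (cd_scale r a) = cd_scale r (cd_conj a).
Proof. by elim: k a => [//|k IH] a /=; rewrite IH cd_scaleN. Qed.

Lemma cd_conj_sum k (I : Type) (s : seq I) (F : I -> cd k) :
  cd_conj (\sum_(i <- s) F i) = \sum_(i <- s) cd_conj (F i).
Proof.
by elim: s => [|i s IH]; rewrite ?big_nil ?cd_conj0// !big_cons cd_conjD IH.
Qed.

Lemma cd_ip_conj k (a b : cd k) : cd_ip (cd_conj a) (cd_conj b) = cd_ip a b.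
Proof. by elim: k a b => [//|k IH] a b /=; rewrite IH cd_ipNl cd_ipNr opprK. Qed.

Lemma cd_mulD k : (forall a b c : cd k, cd_mul (a + b) c = cd_mul a c + cd_mul b c) /\
  (forall a b c : cd k, cd_mul c (a + b) = cd_mul c a + cd_mul c b).
Proof.
elim: k => [|k [IHl IHr]]; first by split => a b c /=; [rewrite mulrDl|rewrite mulrDr].
by split => -[a1 a2] [b1 b2] [c1 c2] /=;
  rewrite !(cd_conjD, IHl, IHr); congr (_, _); abel.
Qed.

Lemma cd_mulDl k (a b c : cd k) : cd_mul (a + b) c = cd_mul a c + cd_mul b c.
Proof. by have [H _] := cd_mulD k. Qed.

Lemma cd_mulDr k (a b c : cd k) : cd_mul c (a + b) = cd_mul c a + cd_mul c b.
Proof. by have [_ H] := cd_mulD k. Qed.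

Lemma cd_mul0l k (a : cd k) : cd_mul 0 a = 0. Proof. exact: (cd_mul0 a).1. Qed.

Lemma cd_mul0r k (a : cd k) : cd_mul a 0 = 0. Proof. exact: (cd_mul0 a).2. Qed.

Lemma cd_mulNl k (a b : cd k) : cd_mul (- a) b = - cd_mul a b.
Proof. by apply/eqP; rewrite -addr_eq0 -cd_mulDl addNr cd_mul0l. Qed.

Lemma cd_mulNr k (a b : cd k) : cd_mul a (- b) = - cd_mul a b.
Proof. by apply/eqP; rewrite -addr_eq0 -cd_mulDr addNr cd_mul0r. Qed.

Lemma cd_mulZ k r : (forall a b : cd k, cd_mul (cd_scale r a) b = cd_scale r (cd_mul a b)) /\
  (forall a b : cd k, cd_mul a (cd_scale r b) = cd_scale r (cd_mul a b)).
Proof.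
elim: k => [|k [IHl IHr]]; first by split => a b /=; [rewrite mulrA|rewrite mulrCA].
split => -[a1 a2] [b1 b2] /=; rewrite !(cd_conjZ, IHl, IHr); congr (_, _); abel.
Qed.

Lemma cd_mulZl k r (a b : cd k) : cd_mul (cd_scale r a) b = cd_scale r (cd_mul a b).
Proof. by have [H _] := cd_mulZ k r. Qed.

Lemma cd_mulZr k r (a b : cd k) : cd_mul a (cd_scale r b) = cd_scale r (cd_mul a b).
Proof. by have [_ H] := cd_mulZ k r. Qed.

Lemma cd_mul_suml k (I : Type) (s : seq I) (F : I -> cd k) a :
  cd_mul (\sum_(i <- s) F i) a = \sum_(i <- s) cd_mul (F i) a.
Proof.
by elim: s => [|i s IH]; rewrite ?big_nil ?cd_mul0l// !big_cons cd_mulDl IH.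
Qed.

Lemma cd_mul_sumr k (I : Type) (s : seq I) (F : I -> cd k) a :
  cd_mul a (\sum_(i <- s) F i) = \sum_(i <- s) cd_mul a (F i).
Proof.
by elim: s => [|i s IH]; rewrite ?big_nil ?cd_mul0r// !big_cons cd_mulDr IH.
Qed.

Lemma cd_mul1 k : (forall a : cd k, cd_mul (cd_one R k) a = a) /\
  (forall a : cd k, cd_mul a (cd_one R k) = a).
Proof.
elim: k => [|k [IHl IHr]]; first by split => a /=; [rewrite mul1r|rewrite mulr1].
by split => -[a1 a2] /=; rewrite ?cd_conj0 ?cd_conj1 ?cd_mul0l ?cd_mul0r !(IHl, IHr)
  ?subr0 ?addr0 ?add0r.
Qed.

Lemma cd_mul1l k (a : cd k) : cd_mul (cd_one R k) a = a.
Proof. by have [H _] := cd_mul1 k. Qed.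

Lemma cd_mul1r k (a : cd k) : cd_mul a (cd_one R k) = a.
Proof. by have [_ H] := cd_mul1 k. Qed.

Lemma cd_conjM k (a b : cd k) : cd_conj (cd_mul a b) = cd_mul (cd_conj b) (cd_conj a).
Proof.
elim: k a b => [|k IH] a b /=; first by rewrite mulrC.
rewrite !(cd_conjD, cd_conjN, IH, cd_conjK, cd_mulNl, cd_mulNr).
by congr (_, _); abel.
Qed.

Lemma cd_re_ip k (a : cd k) : cd_re a = cd_ip a (cd_one R k).
Proof. by elim: k a => [|k IH] a /=; rewrite ?mulr1// IH cd_ip0r addr0. Qed.

Lemma cd_re_mul k (a b : cd k) : cd_re (cd_mul a b) = cd_ip a (cd_conj b).
Proof.
elim: k a b => [//|k IH] a b /=.
have reB (x y : cd k) : cd_re (x - y) = cd_re x - cd_re y.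
  by rewrite !cd_re_ip cd_ipDl cd_ipNl.
by rewrite reB !IH cd_ip_conj cd_ipNr (cd_ipC b.2).
Qed.

Lemma cd_ip_mulr k (a b c : cd k) : cd_ip (cd_mul a b) c = cd_ip a (cd_mul c (cd_conj b)).
Proof.
elim: k a b c => [|k IH] a b c /=; first by rewrite -mulrA [b * c]mulrC.
have IHl (x y z : cd k) : cd_ip (cd_mul x y) z = cd_ip y (cd_mul (cd_conj x) z).
  by rewrite -cd_ip_conj cd_conjM IH cd_conjK -cd_ip_conj cd_conjK cd_conjM cd_conjK.
rewrite !(cd_ipDl, cd_ipDr, cd_ipNl, cd_ipNr, cd_conjN, cd_mulNl, cd_mulNr, cd_conjK).
rewrite (IH a.1 b.1) (IHl b.2 a.1) (IHl (cd_conj b.2) a.2) (IH a.2 (cd_conj b.1)).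
by rewrite !cd_conjK; ring.
Qed.

Lemma cd_ip_mull k (a b c : cd k) : cd_ip (cd_mul a b) c = cd_ip b (cd_mul (cd_conj a) c).
Proof.
by rewrite -cd_ip_conj cd_conjM cd_ip_mulr cd_conjK -cd_ip_conj cd_conjK cd_conjM cd_conjK.
Qed.

Lemma cd_mul_conj k : (forall a : cd k, cd_mul a (cd_conj a) = cd_scale (cd_ip a a) (cd_one R k)) /\
  (forall a : cd k, cd_mul (cd_conj a) a = cd_scale (cd_ip a a) (cd_one R k)).
Proof.
elim: k => [|k [IHl IHr]]; first by split => a /=; rewrite mulr1.
split => -[a b] /=; rewrite ?cd_conjN ?cd_mulNl ?cd_mulNr ?cd_conjK !(IHl, IHr) cd_scaler0;
  congr (_, _); abel.
Qed.

Lemma cd_mul_conjr k (a : cd k) : cd_mul a (cd_conj a) = cd_scale (cd_ip a a) (cd_one R k).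
Proof. by have [H _] := cd_mul_conj k. Qed.

Lemma cd_mul_conjl k (a : cd k) : cd_mul (cd_conj a) a = cd_scale (cd_ip a a) (cd_one R k).
Proof. by have [_ H] := cd_mul_conj k. Qed.

Lemma cd_real k (a : cd k) : cd_conj a = a -> a = cd_scale (cd_re a) (cd_one R k).
Proof.
elim: k a => [|k IH] a /=; first by rewrite mulr1.
case: a => a b /= [/IH ea eb]; rewrite cd_scaler0 -ea; congr (_, _).
by apply: cd_ip_ext => c; rewrite cd_ip0l; have := congr1 (fun x : cd k => cd_ip x c) eb; rewrite cd_ipNl; lra.
Qed.

Lemma cd_re_conj k (a : cd k) : cd_re (cd_conj a) = cd_re a.
Proof. by rewrite !cd_re_ip -[cd_one R k]cd_conj1 cd_ip_conj cd_conj1. Qed.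

Lemma cd_add_conj k (a : cd k) : a + cd_conj a = cd_scale (2 * cd_re a) (cd_one R k).
Proof.
rewrite [LHS]cd_real; last by rewrite cd_conjD cd_conjK addrC.
by rewrite !cd_re_ip cd_ipDl -!cd_re_ip cd_re_conj mulr_natl.
Qed.

Lemma cd_ip_one k : cd_ip (cd_one R k) (cd_one R k) = 1.
Proof. by elim: k => [|k IH] /=; rewrite ?mulr1// IH cd_ip0l addr0. Qed.

Fixpoint cd_basis k : seq (cd k) :=
  match k return seq (cd k) with
  | 0 => [:: 1 : R]
  | k'.+1 => [seq (e, 0) | e <- cd_basis k'] ++ [seq (0, e) | e <- cd_basis k']
  end.

Lemma size_cd_basis k : size (cd_basis k) = (2 ^ k)%N.
Proof. by elim: k => [//|k IH]; rewrite /= size_cat !size_map IH expnS mul2n addnn. Qed.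

Lemma cd_basis_unit k e : e \in cd_basis k -> cd_ip e e = 1.
Proof.
elim: k e => [|k IH] e /=; first by rewrite inE => /eqP ->; rewrite mulr1.
rewrite mem_cat => /orP[] /mapP[f fb ->] /=; rewrite cd_ip0l ?addr0 ?add0r; exact: IH.
Qed.

Lemma cd_parseval k (a b : cd k) :
  \sum_(e <- cd_basis k) cd_ip a e * cd_ip b e = cd_ip a b.
Proof.
elim: k a b => [|k IH] a b /=; first by rewrite big_seq1 /= !mulr1.
rewrite big_cat /= !big_map /= -(IH a.1 b.1) -(IH a.2 b.2); congr (_ + _); apply: eq_bigr => e _.
  by rewrite /= !cd_ip0r !addr0.
by rewrite /= !cd_ip0r !add0r.
Qed.

End CayleyDicksonAlgebra.

Section CayleyDicksonIdentities.
Variable R : realType.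
Notation cd := (cd R).

Local Ltac abel := apply: cd_ip_ext => ?;
  rewrite ?(cd_ipDl, cd_ipNl, cd_ipZl, cd_ip0l); ring.

Definition cd_associative k :=
  forall a b c : cd k, cd_mul (cd_mul a b) c = cd_mul a (cd_mul b c).

Lemma cd_mulC1 (a b : cd 1) : cd_mul a b = cd_mul b a.
Proof.
case: a b => [a1 a2] [b1 b2] /=; rewrite (mulrC b1) (mulrC b2 a2).
by congr (_, _); rewrite addrC.
Qed.

Lemma cd_associativeS k : cd_associative k ->
  (forall a b : cd k, cd_mul a b = cd_mul b a) -> cd_associative k.+1.
Proof.
move=> A C [a1 a2] [b1 b2] [c1 c2] /=.
rewrite !(cd_conjD, cd_conjN, cd_conjM, cd_conjK, cd_mulDl, cd_mulDr, cd_mulNl, cd_mulNr).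
have rot (x y z : cd k) : cd_mul x (cd_mul y z) = cd_mul y (cd_mul z x).
  by rewrite C A.
rewrite !A (rot c1) (rot a1 (cd_conj c2)) (rot (cd_conj b1)).
rewrite (C b1 a1) (C (cd_conj c1) a1) (C (cd_conj c1)) (rot a2 (cd_conj b2)).
rewrite (rot (cd_conj b2) c2) (C a2 (cd_conj b2)).
by congr (_, _); abel.
Qed.

Lemma cd_associative0 : cd_associative 0.
Proof. by move=> a b c; rewrite /= mulrA. Qed.

Lemma cd_associative_le2 k : (k <= 2)%N -> cd_associative k.
Proof.
have A1 : cd_associative 1.
  by apply: cd_associativeS cd_associative0 _ => a b; exact: mulrC.
case: k => [|[|[|k]]] // _; first exact: cd_associative0.
exact: cd_associativeS A1 cd_mulC1.
Qed.

Lemma cd_inverse_propertyS k : cd_associative k -> forall a b : cd k.+1,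
  cd_mul (cd_conj a) (cd_mul a b) = cd_scale (cd_ip a a) b.
Proof.
move=> A [a1 a2] [b1 b2] /=.
rewrite !(cd_conjD, cd_conjN, cd_conjM, cd_conjK, cd_mulDl, cd_mulDr, cd_mulNl, cd_mulNr).
rewrite !A cd_mul_conjl cd_mul_conjr -(A _ a1 b1) -(A a2 _ b2) cd_mul_conjl cd_mul_conjr.
rewrite !(cd_mulZl, cd_mulZr, cd_mul1l, cd_mul1r).
by congr (_, _); abel.
Qed.

Section Alternative.
Variable k : nat.
Hypothesis k3 : (k <= 3)%N.
Implicit Types a b c u x y z w : cd k.

Lemma cd_conj_mulK a b : cd_mul (cd_conj a) (cd_mul a b) = cd_scale (cd_ip a a) b.
Proof.
move: a b; case: k k3 => [|k'] k'3 a b; last exact/cd_inverse_propertyS/cd_associative_le2.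
by rewrite /= mulrA.
Qed.

Lemma cd_ip_mul a b : cd_ip (cd_mul a b) (cd_mul a b) = cd_ip a a * cd_ip b b.
Proof. by rewrite cd_ip_mull cd_conj_mulK cd_ipZr. Qed.

Lemma cd_alternativel a b : cd_mul (cd_mul a a) b = cd_mul a (cd_mul a b).
Proof.
have aE x : cd_mul a x = cd_scale (2 * cd_re a) x - cd_mul (cd_conj a) x.
  by rewrite -[X in cd_scale _ X]cd_mul1l -cd_mulZl -cd_add_conj cd_mulDl addrK.
rewrite (aE (cd_mul a b)) (aE a) cd_mulDl cd_mulNl cd_mulZl cd_conj_mulK.
by rewrite cd_mul_conjl cd_mulZl cd_mul1l.
Qed.

Lemma cd_alternativer a b : cd_mul b (cd_mul a a) = cd_mul (cd_mul b a) a.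
Proof.
by apply: (can_inj (@cd_conjK R k)); rewrite !cd_conjM cd_alternativel.
Qed.

Definition associator a b c := cd_mul (cd_mul a b) c - cd_mul a (cd_mul b c).

Lemma associator_swapl a b c : associator b a c = - associator a b c.
Proof.
have := cd_alternativel (a + b) c; rewrite !(cd_mulDl, cd_mulDr) => E.
apply: cd_ip_ext => x; have := congr1 (fun y : cd k => cd_ip y x) E.
have := congr1 (fun y : cd k => cd_ip y x) (cd_alternativel a c).
have := congr1 (fun y : cd k => cd_ip y x) (cd_alternativel b c).
by rewrite /associator ?(cd_ipDl, cd_ipNl) => ? ? ?; lra.
Qed.

Lemma associator_swapr a b c : associator a c b = - associator a b c.
Proof.
have := cd_alternativer (b + c) a; rewrite !(cd_mulDl, cd_mulDr) => E.
apply: cd_ip_ext => x; have := congr1 (fun y : cd k => cd_ip y x) E.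
have := congr1 (fun y : cd k => cd_ip y x) (cd_alternativer b a).
have := congr1 (fun y : cd k => cd_ip y x) (cd_alternativer c a).
by rewrite /associator ?(cd_ipDl, cd_ipNl) => ? ? ?; lra.
Qed.

Lemma cd_flexible a b : cd_mul (cd_mul a b) a = cd_mul a (cd_mul b a).
Proof.
apply/eqP; rewrite -subr_eq0 -/(associator a b a) associator_swapr.
by rewrite /associator cd_alternativel subrr oppr0.
Qed.

Lemma cd_moufangl u x w :
  cd_mul (cd_mul (cd_mul u x) u) w = cd_mul u (cd_mul x (cd_mul u w)).
Proof.
have e1 := associator_swapl u (cd_mul u x) w.
have e2 := associator_swapr u (cd_mul u w) x.
have e3 := associator_swapr (cd_mul u u) x w.
have e4 := associator_swapr u x w.
rewrite /associator in e1 e2 e3 e4.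
rewrite -!cd_alternativel in e1 e2.
have e5 := congr1 (cd_mul u) e4.
rewrite !(cd_mulDr, cd_mulNr) -!cd_alternativel in e5.
apply: cd_ip_ext => c; move: e1 e2 e3 e5.
move=> /(congr1 (fun y : cd k => cd_ip y c)) + /(congr1 (fun y : cd k => cd_ip y c)) +
  /(congr1 (fun y : cd k => cd_ip y c)) + /(congr1 (fun y : cd k => cd_ip y c)).
by rewrite ?(cd_ipDl, cd_ipNl) => ? ? ? ?; lra.
Qed.

Lemma cd_moufangr u x w :
  cd_mul w (cd_mul (cd_mul u x) u) = cd_mul (cd_mul (cd_mul w u) x) u.
Proof.
apply: (can_inj (@cd_conjK R k)); rewrite !cd_conjM -cd_moufangl cd_flexible.
by [].
Qed.

Lemma cd_moufangm u x w :
  cd_mul (cd_mul u x) (cd_mul w u) = cd_mul (cd_mul u (cd_mul x w)) u.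
Proof.
apply: cd_ip_ext => y; rewrite cd_ip_mulr cd_ip_mull cd_conjM.
rewrite -cd_moufangl [RHS]cd_ip_mulr [RHS]cd_ip_mull [RHS]cd_ip_mulr.
by rewrite cd_flexible.
Qed.

Section Unit.
Variable u : cd k.
Hypothesis u1 : cd_ip u u = 1.

Lemma cd_unit_conj : cd_ip (cd_conj u) (cd_conj u) = 1.
Proof. by rewrite cd_ip_conj. Qed.

Lemma cd_unitK x : cd_mul (cd_conj u) (cd_mul u x) = x.
Proof. by rewrite cd_conj_mulK u1 cd_scale1. Qed.

Lemma cd_unitKr x : cd_mul (cd_mul x u) (cd_conj u) = x.
Proof.
apply: (can_inj (@cd_conjK R k)); rewrite !cd_conjM cd_conj_mulK cd_unit_conj.
exact: cd_scale1.
Qed.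

End Unit.
End Alternative.
End CayleyDicksonIdentities.

(** * Projective spaces *)

Section Projectors.
Variables (R : realType) (k n : nat).
Notation cd := (cd R k).
Notation M := 'M[cd]_n.+1.
Implicit Types (A B : M) (i j l : 'I_n.+1).

Definition mx_inner A B : R := \sum_i \sum_j cd_ip (A i j) (B i j).

Lemma cd_re_sum (I : Type) (s : seq I) (F : I -> cd) :
  cd_re (\sum_(i <- s) F i) = \sum_(i <- s) cd_re (F i).
Proof. by rewrite cd_re_ip cd_ip_suml; apply: eq_bigr => i _; rewrite cd_re_ip. Qed.

Lemma cd_hermitianP A : reflect (forall i j, A j i = cd_conj (A i j)) (cd_hermitian A).
Proof.
apply: (iffP eqP) => [E i j|E]; first by rewrite -{1}E !mxE.
by apply/matrixP => i j; rewrite !mxE -E.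
Qed.

Lemma cd_innerE A B : cd_hermitian B -> cd_inner A B = mx_inner A B.
Proof.
move=> /cd_hermitianP hB; rewrite /cd_inner /mxtrace cd_re_sum; apply: eq_bigr => i _.
by rewrite mxE cd_re_sum; apply: eq_bigr => j _; rewrite cd_re_mul -hB.
Qed.

Lemma projectorP A : reflect
  [/\ forall i j, A j i = cd_conj (A i j),
      forall i j, \sum_l cd_mul (A i l) (A l j) = A i j
    & \sum_i cd_re (A i i) = 1] (projector A).
Proof.
apply: (iffP and3P) => [[/cd_hermitianP hA /eqP AA /eqP tA]|[hA AA tA]]; split => //.
- by move=> i j; rewrite -[in RHS]AA mxE.
- by rewrite -cd_re_sum -/(mxtrace A) tA cd_re_ip cd_ip_one.
- exact/cd_hermitianP.
- by apply/eqP/matrixP => i j; rewrite mxE AA.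
- apply/eqP; rewrite /mxtrace -[RHS]cd_scale1 -tA cd_scale_suml.
  by apply: eq_bigr => i _; apply: cd_real; rewrite -hA.
Qed.

Section OneProjector.
Variable A : M.
Hypothesis pA : projector A.

Lemma projector_conj i j : A j i = cd_conj (A i j).
Proof. by have [/(_ i j)] := projectorP _ pA. Qed.

Lemma projector_mul i j : \sum_l cd_mul (A i l) (A l j) = A i j.
Proof. by have [_ /(_ i j)] := projectorP _ pA. Qed.

Lemma projector_trace : \sum_i cd_re (A i i) = 1.
Proof. by have [] := projectorP _ pA. Qed.

Lemma projector_diag i : A i i = cd_scale (cd_re (A i i)) (cd_one R k).
Proof. by apply: cd_real; rewrite -projector_conj. Qed.

Lemma projector_row i : \sum_j cd_ip (A i j) (A i j) = cd_re (A i i).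
Proof.
rewrite -[in RHS]projector_mul cd_re_sum; apply: eq_bigr => j _.
by rewrite cd_re_mul -projector_conj.
Qed.

Lemma projector_diag_ge0 i : 0 <= cd_re (A i i).
Proof. by rewrite -projector_row sumr_ge0// => j _; exact: cd_ip_ge0. Qed.

Lemma projector_row0 i j : cd_re (A i i) = 0 -> A i j = 0.
Proof.
rewrite -projector_row => /eqP; rewrite psumr_eq0 => [|l _]; last exact: cd_ip_ge0.
by move=> /allP /(_ j (mem_index_enum _)) /= /eqP /cd_ip_eq0.
Qed.

Lemma projector_norm : mx_inner A A = 1.
Proof.
rewrite /mx_inner -projector_trace; apply: eq_bigr => i _; exact: projector_row.
Qed.

(* Rank one, without eigenvectors: the matrix with entries
   [A i i * A l m - A l i * A i m] has squared norm 0, and its [(j, j)] entry is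
   the difference of the two sides. *)
Lemma projector_minor i j : (k <= 3)%N ->
  cd_re (A i i) * cd_re (A j j) = cd_ip (A i j) (A i j).
Proof.
move=> k3; set a := cd_re (A i i).
have [a0|a0] := eqVneq a 0; first by rewrite a0 mul0r (projector_row0 _ a0) cd_ip0l.
pose D l m := cd_scale a (A l m) - cd_mul (A l i) (A i m).
have cross l m : cd_ip (A l m) (cd_mul (A l i) (A i m))
    = cd_ip (A i m) (cd_mul (A i l) (A l m)).
  by rewrite cd_ipC cd_ip_mull -projector_conj.
have S : \sum_l \sum_m cd_ip (D l m) (D l m) = 0.
  transitivity (a ^+ 2 * mx_inner A A
      - 2 * a * (\sum_l \sum_m cd_ip (A i m) (cd_mul (A i l) (A l m)))
      + (\sum_l cd_ip (A i l) (A i l)) * (\sum_m cd_ip (A i m) (A i m))).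
    rewrite /mx_inner mulr_suml !mulr_sumr -sumrB -big_split /=; apply: eq_bigr => l _.
    rewrite !mulr_sumr -sumrB -big_split /=; apply: eq_bigr => m _.
    rewrite /D !(cd_ipDl, cd_ipDr, cd_ipNl, cd_ipNr, cd_ipZl, cd_ipZr) cd_ip_mul//.
    rewrite [cd_ip (cd_mul _ _) _]cd_ipC cross (projector_conj i l) cd_ip_conj; ring.
  rewrite exchange_big /=.
  under [X in _ - _ * X]eq_bigr do rewrite -cd_ip_sumr projector_mul.
  rewrite projector_norm projector_row -/a; ring.
have /eqP := S; rewrite psumr_eq0 => [|l _]; last by apply: sumr_ge0 => m _; exact: cd_ip_ge0.
move=> /allP /(_ j (mem_index_enum _)) /=.
rewrite psumr_eq0 => [|m _]; last exact: cd_ip_ge0.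
move=> /allP /(_ j (mem_index_enum _)) /= /eqP /cd_ip_eq0 /eqP.
rewrite /D subr_eq0 (projector_conj i j) cd_mul_conjl => /eqP.
move=> /(congr1 (@cd_re R k)); rewrite !cd_re_ip !cd_ipZl cd_ip_one mulr1 -cd_re_ip.
by [].
Qed.

End OneProjector.
End Projectors.

Section ProjectiveIsometries.
Variables (R : realType) (k n : nat).
Notation cd := (cd R k).
Notation M := 'M[cd]_n.+1.
Notation T := (projective R k n).
Implicit Types (A B : M) (i j l : 'I_n.+1).

Definition congruent (P Q : T) := exists g : T -> T,
  [/\ bijective g, forall X Y, mx_inner (val (g X)) (val (g Y)) = mx_inner (val X) (val Y)
    & g P = Q].

Lemma congruent_trans P Q S : congruent P Q -> congruent Q S -> congruent P S.
Proof.
move=> [g [bg ig <-]] [h [bh ih <-]]; exists (h \o g); split => //.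
  exact: bij_comp.
by move=> X Y /=; rewrite ih ig.
Qed.

Lemma congruent_refl P : congruent P P.
Proof. by exists id; split => //; exists id. Qed.

Lemma congruent_sym P Q : congruent P Q -> congruent Q P.
Proof.
move=> [g [[h gh hg] ig <-]]; exists h; split; last exact: gh.
  by exists g.
by move=> X Y; rewrite -ig !hg.
Qed.

Lemma congruent_map (f g : M -> M) :
  (forall A, projector A -> projector (f A)) ->
  (forall A, projector A -> projector (g A)) ->
  (forall A, projector A -> g (f A) = A) ->
  (forall A, projector A -> f (g A) = A) ->
  (forall A B, mx_inner (f A) (f B) = mx_inner A B) ->
  forall P : T, exists2 Q : T, congruent P Q & val Q = f (val P).
Proof.
move=> pf pg fK gK fi P.
pose F (X : T) : T := exist _ (f (val X)) (pf _ (valP X)).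
pose G (X : T) : T := exist _ (g (val X)) (pg _ (valP X)).
exists (F P) => //; exists F; split; [|by move=> X Y; exact: fi|by []].
by exists G => X; apply: val_inj; rewrite /= ?fK ?gK//; exact: valP.
Qed.

Record phase (F : 'I_n.+1 -> 'I_n.+1 -> cd -> cd) : Prop := Phase {
  phaseD : forall i j x y, F i j (x + y) = F i j x + F i j y;
  phaseZ : forall i j r x, F i j (cd_scale r x) = cd_scale r (F i j x);
  phase_conj : forall i j x, F j i (cd_conj x) = cd_conj (F i j x);
  phase_ip : forall i j x y, cd_ip (F i j x) (F i j y) = cd_ip x y;
  phase1 : forall i, F i i (cd_one R k) = cd_one R k;
  phaseM : forall i l j x y, i != l -> l != j -> i != j ->
    cd_mul (F i l x) (F l j y) = F i j (cd_mul x y) }.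

Definition entrywise (F : 'I_n.+1 -> 'I_n.+1 -> cd -> cd) A : M :=
  \matrix_(i, j) F i j (A i j).

Section Phase.
Variable F : 'I_n.+1 -> 'I_n.+1 -> cd -> cd.
Hypothesis pF : phase F.

Lemma phase_sum i j (I : Type) (r : seq I) (x : I -> cd) :
  F i j (\sum_(m <- r) x m) = \sum_(m <- r) F i j (x m).
Proof.
elim: r => [|m r IH]; last by rewrite !big_cons phaseD// IH.
by rewrite !big_nil; have := phaseZ pF i j 0 0; rewrite !cd_scale0.
Qed.

Lemma phase_diag A i : projector A -> F i i (A i i) = A i i.
Proof. by move=> pA; rewrite (projector_diag pA) phaseZ// phase1. Qed.

Lemma entrywise_projector A : projector A -> projector (entrywise F A).
Proof.
move=> pA; apply/projectorP; split => [i j|i j|].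
- by rewrite !mxE (projector_conj pA) phase_conj.
- under eq_bigr do rewrite !mxE; rewrite mxE.
  have [<-{j}|ij] := eqVneq i j.
    rewrite phase_diag// -[RHS](projector_mul pA); apply: eq_bigr => l _.
    by rewrite (projector_conj pA i l) phase_conj// !cd_mul_conjr phase_ip.
  rewrite -[in RHS](projector_mul pA) phase_sum; apply: eq_bigr => l _.
  have [->|il] := eqVneq i l.
    by rewrite phase_diag// (projector_diag pA l) !cd_mulZl !cd_mul1l phaseZ.
  have [<-|lj] := eqVneq l j; last exact: phaseM.
  by rewrite phase_diag// (projector_diag pA l) !cd_mulZr !cd_mul1r phaseZ.
- rewrite -[RHS](projector_trace pA); apply: eq_bigr => i _.
  by rewrite mxE phase_diag.
Qed.

Lemma entrywise_inner A B : mx_inner (entrywise F A) (entrywise F B) = mx_inner A B.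
Proof.
by apply: eq_bigr => i _; apply: eq_bigr => j _; rewrite !mxE phase_ip.
Qed.

End Phase.

Lemma congruent_phase F G : phase F -> phase G ->
  (forall i j x, G i j (F i j x) = x) -> (forall i j x, F i j (G i j x) = x) ->
  forall P : T, exists2 Q : T, congruent P Q & forall i j, val Q i j = F i j (val P i j).
Proof.
move=> pF pG FK GK P.
have [||||Q PQ QE] := @congruent_map (entrywise F) (entrywise G) _ _ _ _ (entrywise_inner pF) P.
- exact: entrywise_projector.
- exact: entrywise_projector.
- by move=> A _; apply/matrixP => i j; rewrite !mxE FK.
- by move=> A _; apply/matrixP => i j; rewrite !mxE GK.
by exists Q => // i j; rewrite QE mxE.
Qed.

Definition lmx (H : 'M[R]_n.+1) A : M := \matrix_(i, j) \sum_l cd_scale (H i l) (A l j).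
Definition rmx (H : 'M[R]_n.+1) A : M := \matrix_(i, j) \sum_l cd_scale (H j l) (A i l).

Section RealOrthogonal.
Variable H : 'M[R]_n.+1.
Hypotheses (HT : H^T = H) (HH : H *m H = 1%:M).

Let f A := lmx H (rmx H A).

Let Hij i j : \sum_l H i l * H l j = (i == j)%:R.
Proof. by have := congr1 (fun X : 'M[R]_n.+1 => X i j) HH; rewrite !mxE. Qed.

Let Hsym i j : H i j = H j i. Proof. by rewrite -{1}HT mxE. Qed.

Let scale_delta (x : 'I_n.+1 -> cd) i : \sum_j cd_scale (i == j)%:R (x j) = x i.
Proof.
rewrite (bigD1 i) //= eqxx cd_scale1 big1 ?addr0// => j /negPf.
by rewrite eq_sym => ->; exact: cd_scale0.
Qed.

Lemma lmx_rmx A : lmx H (rmx H A) = rmx H (lmx H A).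
Proof.
apply/matrixP => i j; rewrite !mxE.
under eq_bigr do rewrite mxE cd_scale_sumr.
under [RHS]eq_bigr do rewrite mxE cd_scale_sumr.
rewrite exchange_big; apply: eq_bigr => l _; apply: eq_bigr => m _.
by rewrite !cd_scaleA mulrC.
Qed.

Lemma lmxK A : lmx H (lmx H A) = A.
Proof.
apply/matrixP => i j; rewrite mxE; under eq_bigr do rewrite mxE cd_scale_sumr.
rewrite exchange_big /=; under eq_bigr do under eq_bigr do rewrite cd_scaleA.
by under eq_bigr do rewrite -cd_scale_suml Hij; exact: scale_delta.
Qed.

Lemma rmxK A : rmx H (rmx H A) = A.
Proof.
apply/matrixP => i j; rewrite mxE; under eq_bigr do rewrite mxE cd_scale_sumr.
rewrite exchange_big /=; under eq_bigr do under eq_bigr do rewrite cd_scaleA.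
by under eq_bigr do rewrite -cd_scale_suml Hij; exact: scale_delta.
Qed.

Lemma conj_lmx A B : (forall i j, B j i = cd_conj (A i j)) ->
  forall i j, rmx H B j i = cd_conj (lmx H A i j).
Proof.
move=> AB i j; rewrite !mxE cd_conj_sum; apply: eq_bigr => l _.
by rewrite cd_conjZ -AB.
Qed.

Lemma conj_rmx A B : (forall i j, B j i = cd_conj (A i j)) ->
  forall i j, lmx H B j i = cd_conj (rmx H A i j).
Proof.
move=> AB i j; rewrite !mxE cd_conj_sum; apply: eq_bigr => l _.
by rewrite cd_conjZ -AB.
Qed.

Lemma mul_lmx A B i j : \sum_l cd_mul (lmx H A i l) (B l j)
  = \sum_m cd_scale (H i m) (\sum_l cd_mul (A m l) (B l j)).
Proof.
under eq_bigr do rewrite mxE cd_mul_suml; rewrite exchange_big; apply: eq_bigr => m _.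
by rewrite cd_scale_sumr; apply: eq_bigr => l _; rewrite cd_mulZl.
Qed.

Lemma mul_rmx_lmx A B i j : \sum_l cd_mul (rmx H A i l) (lmx H B l j)
  = \sum_l cd_mul (A i l) (B l j).
Proof.
transitivity (\sum_l \sum_m \sum_m' cd_scale (H l m * H l m') (cd_mul (A i m) (B m' j))).
  apply: eq_bigr => l _; rewrite !mxE cd_mul_suml; apply: eq_bigr => m _.
  rewrite cd_mul_sumr; apply: eq_bigr => m' _.
  by rewrite cd_mulZl cd_mulZr cd_scaleA.
rewrite exchange_big; apply: eq_bigr => m _; rewrite exchange_big /=.
under eq_bigr => m' _.
  rewrite -cd_scale_suml; under eq_bigr do rewrite Hsym; rewrite Hij; over.
exact: (scale_delta (fun m' => cd_mul (A i m) (B m' j))).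
Qed.

Lemma mul_rmx A B i j : \sum_l cd_mul (A i l) (rmx H B l j)
  = \sum_m cd_scale (H j m) (\sum_l cd_mul (A i l) (B l m)).
Proof.
under eq_bigr do rewrite mxE cd_mul_sumr; rewrite exchange_big; apply: eq_bigr => m _.
by rewrite cd_scale_sumr; apply: eq_bigr => l _; rewrite cd_mulZr.
Qed.

Lemma re_orthogonal A i : cd_re (f A i i) = \sum_l \sum_m H i l * H i m * cd_re (A l m).
Proof.
rewrite mxE cd_re_sum; apply: eq_bigr => l _; rewrite mxE cd_scale_sumr cd_re_sum.
by apply: eq_bigr => m _; rewrite cd_scaleA !cd_re_ip cd_ipZl.
Qed.

Lemma orthogonal_projector A : projector A -> projector (f A).
Proof.
move=> pA; have hA := projector_conj pA; apply/projectorP; split => [i j|i j|].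
- by rewrite {2}/f lmx_rmx; apply: conj_rmx; exact: conj_lmx.
- rewrite {1}/f lmx_rmx mul_rmx_lmx mul_lmx [RHS]mxE; apply: eq_bigr => m _.
  congr cd_scale; rewrite mul_rmx [RHS]mxE; apply: eq_bigr => l _.
  by rewrite (projector_mul pA).
- rewrite -[RHS](projector_trace pA).
  under eq_bigr do rewrite re_orthogonal.
  rewrite exchange_big; apply: eq_bigr => l _; rewrite exchange_big /=.
  under eq_bigr => m _.
    rewrite -mulr_suml; under eq_bigr do rewrite Hsym; rewrite Hij; over.
  rewrite (bigD1 l) //= eqxx mul1r big1 ?addr0// => m /negPf.
  by rewrite eq_sym => ->; rewrite mul0r.
Qed.

Lemma lmx_adjoint A B : mx_inner (lmx H A) B = mx_inner A (lmx H B).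
Proof.
rewrite /mx_inner exchange_big [RHS]exchange_big; apply: eq_bigr => j _ /=.
under eq_bigr do rewrite mxE cd_ip_suml.
under [RHS]eq_bigr do rewrite mxE cd_ip_sumr.
rewrite exchange_big; apply: eq_bigr => i _; apply: eq_bigr => l _.
by rewrite cd_ipZl cd_ipZr Hsym.
Qed.

Lemma rmx_adjoint A B : mx_inner (rmx H A) B = mx_inner A (rmx H B).
Proof.
rewrite /mx_inner; apply: eq_bigr => j _ /=.
under eq_bigr do rewrite mxE cd_ip_suml.
under [RHS]eq_bigr do rewrite mxE cd_ip_sumr.
rewrite exchange_big; apply: eq_bigr => i _; apply: eq_bigr => l _.
by rewrite cd_ipZl cd_ipZr Hsym.
Qed.

Lemma orthogonalK A : f (f A) = A.
Proof. by rewrite /f -lmx_rmx lmxK rmxK. Qed.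

Lemma congruent_orthogonal (P : T) : exists2 Q : T, congruent P Q
  & forall i, cd_re (val Q i i) = \sum_l \sum_m H i l * H i m * cd_re (val P l m).
Proof.
have fi A B : mx_inner (f A) (f B) = mx_inner A B.
  by rewrite lmx_adjoint /f lmxK rmx_adjoint rmxK.
have fp := orthogonal_projector.
have [Q PQ QE] := congruent_map fp fp (fun A _ => orthogonalK A) (fun A _ => orthogonalK A) fi P.
by exists Q => // i; rewrite QE re_orthogonal.
Qed.

End RealOrthogonal.
End ProjectiveIsometries.

Section Phases.
Variable R : realType.
Notation cd := (cd R).

Section UnitElement.
Variables (k : nat) (u : cd k).
Hypotheses (k3 : (k <= 3)%N) (u1 : cd_ip u u = 1).

Lemma cd_unitVK x : cd_mul u (cd_mul (cd_conj u) x) = x.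
Proof. by rewrite -{1}[u]cd_conjK cd_unitK// cd_unit_conj. Qed.

Lemma cd_unitVKr x : cd_mul (cd_mul x (cd_conj u)) u = x.
Proof. by rewrite -{2}[u]cd_conjK cd_unitKr// cd_unit_conj. Qed.

Lemma cd_unit_ipl x y : cd_ip (cd_mul u x) (cd_mul u y) = cd_ip x y.
Proof. by rewrite cd_ip_mull cd_unitK. Qed.

Lemma cd_unit_ipr x y : cd_ip (cd_mul x u) (cd_mul y u) = cd_ip x y.
Proof. by rewrite cd_ip_mulr cd_unitKr. Qed.

End UnitElement.

Lemma phase_relabel k n (F : 'I_n.+1 -> 'I_n.+1 -> cd k -> cd k) (t : 'I_n.+1 -> 'I_n.+1) :
  injective t -> phase F -> phase (fun i j => F (t i) (t j)).
Proof.
move=> tI [fD fZ fC fI f1 fM]; split => //.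
by move=> i l j x y il lj ij; rewrite fM// (inj_eq tI).
Qed.

Lemma conjugation_phase k n (u : 'I_n.+1 -> cd k) : (k <= 2)%N ->
  (forall i, cd_ip (u i) (u i) = 1) ->
  phase (fun i j x => cd_mul (cd_mul (u i) x) (cd_conj (u j))).
Proof.
move=> k2 u1; have A := @cd_associative_le2 R k k2.
have k3 : (k <= 3)%N := leqW k2.
split=> [i j x y|i j r x|i j x|i j x y|i|i l j x y _ _ _].
- by rewrite cd_mulDr cd_mulDl.
- by rewrite cd_mulZr cd_mulZl.
- by rewrite !cd_conjM cd_conjK A.
- by rewrite cd_unit_ipr ?cd_unit_conj// cd_unit_ipl.
- by rewrite cd_mul1r cd_mul_conjr u1 cd_scale1.
- by rewrite !A cd_unitK.
Qed.

(* The Moufang identities say that this change of the three independent entries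
   of an octonionic projector is compatible with the matrix product. *)
Definition triality k (u : cd k) (i j : 'I_3) (x : cd k) : cd k :=
  match val i, val j with
  | 0, 1 => cd_mul u x
  | 1, 0 => cd_mul x (cd_conj u)
  | 1, 2 => cd_mul x u
  | 2, 1 => cd_mul (cd_conj u) x
  | 2, 0 => cd_mul (cd_mul (cd_conj u) x) (cd_conj u)
  | 0, 2 => cd_mul (cd_mul u x) u
  | _, _ => x
  end.

Lemma triality_phase k (u : cd k) : (k <= 3)%N -> cd_ip u u = 1 ->
  phase (triality u).
Proof.
move=> k3 u1; have v1 := cd_unit_conj u1.
split=> [i j x y|i j r x|i j x|i j x y|i|i l j x y].
- by case: i j => [[|[|[|?]]] ?] [[|[|[|?]]] ?]; rewrite /triality /= ?cd_mulDr ?cd_mulDl.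
- by case: i j => [[|[|[|?]]] ?] [[|[|[|?]]] ?]; rewrite /triality /= ?cd_mulZr ?cd_mulZl.
- by case: i j => [[|[|[|?]]] ?] [[|[|[|?]]] ?];
    rewrite /triality /= ?cd_conjM ?cd_conjK ?cd_flexible.
- by case: i j => [[|[|[|?]]] ?] [[|[|[|?]]] ?]; rewrite /triality /= ?cd_unit_ipr ?cd_unit_ipl.
- by case: i => [[|[|[|?]]] ?].
- case: i l j => [[|[|[|?]]] ?] [[|[|[|?]]] ?] [[|[|[|?]]] ?] //= _ _ _; rewrite /triality /=.
  + by rewrite cd_moufangm.
  + by rewrite cd_moufangl// cd_unitVK.
  + by rewrite cd_moufangr// cd_unitVKr.
  + by rewrite cd_moufangr// cd_unitKr.
  + by rewrite cd_moufangl// cd_unitK.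
  + by rewrite cd_moufangm.
Qed.

Lemma trialityK k (u : cd k) : (k <= 3)%N -> cd_ip u u = 1 ->
  forall i j x, triality (cd_conj u) i j (triality u i j x) = x.
Proof.
move=> k3 u1.
case=> [[|[|[|?]]] ?] [[|[|[|?]]] ?] x //; rewrite /triality /= ?cd_conjK.
- by rewrite cd_unitK.
- by rewrite (cd_flexible k3 u) cd_unitK// cd_unitKr.
- by rewrite cd_unitVKr.
- by rewrite cd_unitKr.
- by rewrite (cd_flexible k3) cd_unitVKr// cd_unitVK.
- by rewrite cd_unitVK.
Qed.

Lemma cd_normalize k (q : cd k) : exists u : cd k, cd_ip u u = 1 /\
  exists r, q = cd_scale r u.
Proof.
have [->|q0] := eqVneq q 0.
  by exists (cd_one R k); split; [exact: cd_ip_one|exists 0; rewrite cd_scale0].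
have n0 : cd_ip q q != 0 by apply/eqP => /cd_ip_eq0 /eqP; rewrite (negPf q0).
pose N := Num.sqrt (cd_ip q q).
have N2 : N ^+ 2 = cd_ip q q by rewrite sqr_sqrtr ?cd_ip_ge0.
have N0 : N != 0 by apply: contra_neq n0 => N0; rewrite -N2 N0 expr0n.
exists (cd_scale N^-1 q); split; last by exists N; rewrite cd_scaleA divff// cd_scale1.
by rewrite cd_ipZl cd_ipZr -N2; field.
Qed.

Lemma real_phase k n (j : 'I_n.+1) (q : cd k) :
  (k <= 2)%N \/ (k <= 3)%N /\ n = 2%N -> j != 0 ->
  exists F G, [/\ @phase R k n F, @phase R k n G, forall i l x, G i l (F i l x) = x,
    forall i l x, F i l (G i l x) = x & exists r, F 0 j q = cd_scale r (cd_one R k)].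
Proof.
have [u [u1 [r qE]]] := cd_normalize q.
move=> [k2|[k3 n2]] j0.
  pose v (i : 'I_n.+1) := if i == j then u else cd_one R k.
  have v1 i : cd_ip (v i) (v i) = 1 by rewrite /v; case: eqP => // _; exact: cd_ip_one.
  have vc1 i : cd_ip (cd_conj (v i)) (cd_conj (v i)) = 1 by rewrite cd_ip_conj.
  have k3 : (k <= 3)%N := leqW k2; have A := @cd_associative_le2 R k k2.
  exists (fun i l x => cd_mul (cd_mul (v i) x) (cd_conj (v l))).
  exists (fun i l x => cd_mul (cd_mul (cd_conj (v i)) x) (cd_conj (cd_conj (v l)))).
  split.
  - exact: conjugation_phase.
  - exact: (conjugation_phase (u := fun i => cd_conj (v i))).
  - move=> i l x; rewrite cd_conjK -!A cd_mul_conjl v1 cd_scale1 cd_mul1l A.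
    by rewrite cd_mul_conjl v1 cd_scale1 cd_mul1r.
  - move=> i l x; rewrite cd_conjK -!A cd_mul_conjr v1 cd_scale1 cd_mul1l A.
    by rewrite cd_mul_conjr v1 cd_scale1 cd_mul1r.
  - exists r; rewrite /v eqxx eq_sym (negPf j0) cd_mul1l qE cd_mulZl cd_mul_conjr u1.
    by rewrite cd_scale1.
move: j j0; rewrite n2 => j j0.
have uc1 := cd_unit_conj u1.
have cc : cd_conj (cd_conj u) = u := cd_conjK u.
have TK := trialityK k3 u1; have TK' := trialityK k3 uc1; rewrite cc in TK'.
have pT := triality_phase k3 u1; have pT' := triality_phase k3 uc1.
have [j1|j2] : j = 1 \/ j = 2%R.
  by case: j j0 => [[|[|[|?]]] ?] // _; [left|right]; apply: val_inj.
- exists (triality (cd_conj u)), (triality u); split => //.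
  exists r; rewrite j1 /triality /= qE cd_mulZr cd_mul_conjl u1.
  by rewrite cd_scale1.
- pose t (i : 'I_3) := i + 1.
  have tI : injective t by exact: addIr.
  exists (fun i l => triality u (t i) (t l)), (fun i l => triality (cd_conj u) (t i) (t l)).
  split; [exact: phase_relabel|exact: phase_relabel|by move=> *; exact: TK|by move=> *; exact: TK'|].
  exists r; rewrite j2 /triality /t /= qE cd_mulZl cd_mul_conjr u1.
  by rewrite cd_scale1.
Qed.

End Phases.

Section ProjectiveTransitivity.
Variables (R : realType) (k n : nat).
Hypothesis kn : (k <= 2)%N \/ (k <= 3)%N /\ n = 2%N.
Notation cd := (cd R k).
Notation T := (projective R k n).
Implicit Types (P Q : T) (i j l : 'I_n.+1).

Let k3 : (k <= 3)%N. Proof. by case: kn => [/leqW|[]]. Qed.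

Lemma big_two_support (w f : 'I_n.+1 -> R) j : j != 0 ->
  (forall l, l != 0 -> l != j -> w l = 0) -> \sum_l w l * f l = w 0 * f 0 + w j * f j.
Proof.
move=> j0 ws; rewrite (bigD1 0)//= (bigD1 j)//= big1 ?addr0// => l /andP[l0 lj].
by rewrite ws// mul0r.
Qed.

Lemma isotropic_unit (a b c : R) : a * c = b ^+ 2 -> exists s t : R,
  s ^+ 2 + t ^+ 2 = 1 /\ s ^+ 2 * a + 2 * s * t * b + t ^+ 2 * c = 0.
Proof.
move=> ac; have [a0|a0] := eqVneq a 0.
  have : b ^+ 2 == 0 by rewrite -ac a0 mul0r.
  rewrite sqrf_eq0 => /eqP ->; exists 1, 0; rewrite a0; split; ring.
have N0 : 0 < a ^+ 2 + b ^+ 2 by rewrite ltr_wpDr ?sqr_ge0// lt0r sqr_ge0 sqrf_eq0 a0.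
pose N := Num.sqrt (a ^+ 2 + b ^+ 2).
have N2 : N ^+ 2 = a ^+ 2 + b ^+ 2 by rewrite sqr_sqrtr// ltW.
have Nn0 : N != 0 by rewrite sqrtr_eq0 -ltNge.
exists (b / N), (- a / N); split.
  by rewrite !exprMn exprVn sqrrN -mulrDl N2 addrC divff// gt_eqF.
transitivity ((a * (a * c - b ^+ 2)) / N ^+ 2); first by field.
by rewrite ac subrr mulr0 mul0r.
Qed.

(* After a phase the entry [0 j] is real; the real [2 x 2] block on [{0, j}] is
   then singular, and a reflection turns its isotropic vector into the [j]-th
   basis vector. *)
Lemma kill_row P j : j != 0 -> exists Q, [/\ congruent P Q, cd_re (val Q j j) = 0 &
  forall i, i != 0 -> i != j -> cd_re (val Q i i) = cd_re (val P i i)].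
Proof.
move=> j0; have [F [G [pF pG FK GK [b bE]]]] := real_phase (val P 0 j) kn j0.
have [P1 PP1 P1E] := congruent_phase pF pG FK GK P.
have pP1 := valP P1.
have P1d i : cd_re (val P1 i i) = cd_re (val P i i).
  by rewrite P1E phase_diag//; exact: valP.
set a := cd_re (val P1 0 0); set c := cd_re (val P1 j j).
have b0j : cd_re (val P1 0 j) = b by rewrite P1E bE cd_re_ip cd_ipZl cd_ip_one mulr1.
have bj0 : cd_re (val P1 j 0) = b by rewrite (projector_conj pP1 0 j) cd_re_conj.
have [s [t [st q0]]] : exists s t : R,
    s ^+ 2 + t ^+ 2 = 1 /\ s ^+ 2 * a + 2 * s * t * b + t ^+ 2 * c = 0.
  apply: isotropic_unit; rewrite (projector_minor pP1 0 j k3) P1E bE.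
  by rewrite cd_ipZl cd_ipZr cd_ip_one mulr1 expr2.
pose w : 'rV[R]_n.+1 := \row_i (if i == 0 then s else if i == j then t else 0).
have w0 : w 0 0 = s by rewrite mxE.
have wj : w 0 j = t by rewrite mxE (negPf j0) eqxx.
have ws i : i != 0 -> i != j -> w 0 i = 0 by move=> /negPf i0 /negPf ij; rewrite mxE i0 ij.
have [|H [HT HH Hj Hz]] := @householder R n.+1 (delta_mx 0 j) w.
  by rewrite dot_delta mxE !eqxx /= /dot (big_two_support _ j0 ws) w0 wj -!expr2 st.
have Hjl l : H j l = w 0 l by rewrite -Hj -rowE mxE.
have Hil i l : i != 0 -> i != j -> H i l = (i == l)%:R.
  move=> i0 ij; have Hi : (delta_mx 0 i : 'rV[R]_n.+1) *m H = delta_mx 0 i.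
    by apply: Hz; rewrite dot_delta mxE [j == i]eq_sym (negPf ij) andbF dotC dot_delta ws.
  have := congr1 (fun X : 'rV[R]_n.+1 => X 0 l) Hi.
  by rewrite -rowE !mxE eqxx eq_sym.
have [Q P1Q QE] := congruent_orthogonal HT HH P1.
exists Q; split; first exact: congruent_trans PP1 P1Q.
- rewrite QE -[RHS]q0.
  under eq_bigr => l _.
    under eq_bigr do rewrite !Hjl -mulrA; rewrite -mulr_sumr (big_two_support _ j0 ws) w0 wj; over.
  rewrite (big_two_support _ j0 ws) w0 wj b0j bj0 -/a -/c; ring.
- move=> i i0 ij; rewrite QE (bigD1 i)//= [X in _ + X]big1 ?addr0 => [|l /negPf li].
    rewrite (bigD1 i)//= !Hil// eqxx !mul1r big1 ?addr0// => m /negPf mi.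
    by rewrite Hil// eq_sym mi mulr0 mul0r.
  by rewrite big1// => m _; rewrite Hil// eq_sym li !mul0r.
Qed.

Lemma congruent_basepoint P : congruent P point.
Proof.
have [Q [PQ Q0]] : exists Q, congruent P Q /\ forall i, i != 0 -> cd_re (val Q i i) = 0.
  suff: forall m, exists Q, congruent P Q /\
      forall i, i != 0 -> (i <= m)%N -> cd_re (val Q i i) = 0.
    by move=> /(_ n) [Q [PQ Q0]]; exists Q; split=> // i i0; apply: Q0; rewrite // -ltnS.
  elim=> [|m [Q [PQ Q0]]].
    exists P; split; first exact: congruent_refl.
    by move=> i /negP i0; rewrite leqn0 => /eqP i00; case: i0; apply/eqP/val_inj.
  have [mn|nm] := leqP m.+1 n; last first.
    exists Q; split=> // i i0 im; apply: Q0 => //.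
    by rewrite -ltnS (leq_trans (ltn_ord i) nm).
  pose j := Ordinal (mn : (m.+1 < n.+1)%N).
  have j0 : j != 0 by apply/eqP => /(congr1 val).
  have [Q' [QQ' Q'j Q'i]] := kill_row Q j0.
  exists Q'; split; first exact: congruent_trans PQ QQ'.
  move=> i i0 im; have [->//|ij] := eqVneq i j.
  rewrite Q'i// Q0// -ltnS ltn_neqAle im andbT.
  by apply: contra ij => /eqP ij; apply/eqP/val_inj.
suff -> : point = Q by [].
apply/val_inj/matrixP => i j; rewrite mxE; have pQ := valP Q.
have [->|i0] := eqVneq i 0; last by rewrite (projector_row0 pQ)// Q0.
have [->|j0] := eqVneq j 0; last first.
  by rewrite (projector_conj pQ) (projector_row0 pQ) ?cd_conj0// Q0.
have := projector_trace pQ; rewrite (bigD1 0)//= big1 ?addr0 => [Q00|l l0]; last exact: Q0.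
by rewrite (projector_diag pQ) Q00 cd_scale1.
Qed.

Lemma congruent_all P Q : congruent P Q.
Proof.
exact: congruent_trans (congruent_basepoint P) (congruent_sym (congruent_basepoint Q)).
Qed.

End ProjectiveTransitivity.

Section ProjectiveLines.
Variables (R : realType) (k n : nat).
Notation cd := (cd R k).
Notation M := 'M[cd]_n.+1.

Lemma cd_cauchy_schwarz (a b : cd) : cd_ip a b ^+ 2 <= cd_ip a a * cd_ip b b.
Proof.
have [b0|b0] := eqVneq (cd_ip b b) 0; first by rewrite (cd_ip_eq0 b0) !cd_ip0r mulr0 expr0n.
have bb : 0 < cd_ip b b by rewrite lt0r b0 cd_ip_ge0.
have h := cd_ip_ge0 (cd_scale (cd_ip b b) a - cd_scale (cd_ip a b) b).
rewrite !(cd_ipDl, cd_ipDr, cd_ipNl, cd_ipNr, cd_ipZl, cd_ipZr) (cd_ipC b a) in h.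
rewrite -subr_ge0 -(pmulr_rge0 _ bb); apply: le_trans h _.
by rewrite le_eqVlt; apply/orP; left; apply/eqP; ring.
Qed.

Lemma big_zmod_two (V : zmodType) (f : 'I_n.+1 -> V) (j : 'I_n) :
  (forall l, l != 0 -> l != lift 0 j -> f l = 0) -> \sum_l f l = f 0 + f (lift 0 j).
Proof.
move=> f0; rewrite (bigD1 0)//= (bigD1 (lift 0 j))//= big1 ?addr0// => l /andP[l0 lj].
exact: f0.
Qed.

(* The points [v v^* / |v|^2] for [v = e_0 + w e_j]; for [w = z u] with [u] a unit
   and [z] real they run through a geodesic. *)
Definition line_vector (j : 'I_n) (w : cd) (i : 'I_n.+1) : cd :=
  if i == 0 then cd_one R k else if i == lift 0 j then w else 0.

Definition line (j : 'I_n) (w : cd) : M := \matrix_(i, l)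
  cd_scale (1 + cd_ip w w)^-1 (cd_mul (line_vector j w i) (cd_conj (line_vector j w l))).

Section Line.
Variables (j : 'I_n) (w : cd).
Notation v := (line_vector j w).

Let w0 : 1 + cd_ip w w != 0.
Proof. by rewrite gt_eqF// ltr_pwDl// cd_ip_ge0. Qed.

Let v0 : v 0 = cd_one R k. Proof. by []. Qed.

Let vj : v (lift 0 j) = w. Proof. by rewrite /line_vector eqxx. Qed.

Let vn i : i != 0 -> i != lift 0 j -> v i = 0.
Proof. by rewrite /line_vector => /negPf -> /negPf ->. Qed.

Let v_mul i x : (k <= 3)%N ->
  cd_mul (cd_mul (v i) (cd_conj w)) (cd_mul w x) = cd_scale (cd_ip w w) (cd_mul (v i) x).
Proof.
move=> k3; have [->|i0] := eqVneq i 0; first by rewrite v0 !cd_mul1l cd_conj_mulK.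
have [->|ij] := eqVneq i (lift 0 j); last by rewrite vn// !cd_mul0l cd_scaler0.
by rewrite vj cd_mul_conjr cd_mulZl cd_mul1l.
Qed.

Lemma line_projector : (k <= 3)%N -> projector (line j w).
Proof.
move=> k3; apply/projectorP; split => [i l|i l|].
- by rewrite !mxE cd_conjZ cd_conjM cd_conjK.
- rewrite (big_zmod_two (j := j)) => [|m m0 mj].
    rewrite !mxE !cd_mulZl !cd_mulZr v0 vj cd_conj1 cd_mul1r cd_mul1l v_mul//.
    by rewrite !cd_scaleA -cd_scaleDl; congr cd_scale; field.
  by rewrite !mxE (vn m0 mj) cd_mul0l cd_scaler0 cd_mul0r.
- rewrite (big_zmod_two (j := j)) => [|m m0 mj]; rewrite !mxE !cd_mul_conjr !cd_re_ip !cd_ipZl.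
    by rewrite v0 vj !cd_ip_one; field.
  by rewrite (vn m0 mj) cd_ip0l mul0r mulr0.
Qed.

Lemma mx_inner_line (A : M) : projector A -> (1 + cd_ip w w) * mx_inner A (line j w) =
  cd_re (A 0 0) + 2 * cd_ip (A 0 (lift 0 j)) (cd_conj w)
    + cd_ip w w * cd_re (A (lift 0 j) (lift 0 j)).
Proof.
move=> pA; rewrite /mx_inner (big_zmod_two (j := j)) => [|i i0 ij]; last first.
  by rewrite big1// => l _; rewrite mxE (vn i0 ij) cd_mul0l cd_scaler0 cd_ip0r.
have row i : \sum_l cd_ip (A i l) (line j w i l) =
    cd_ip (A i 0) (line j w i 0) + cd_ip (A i (lift 0 j)) (line j w i (lift 0 j)).
  apply: big_zmod_two => l l0 lj.
  by rewrite mxE (vn l0 lj) cd_conj0 cd_mul0r cd_scaler0 cd_ip0r.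
rewrite !row !mxE v0 vj (projector_conj pA 0 (lift 0 j)) !cd_ipZr cd_conj1 !cd_mul1l cd_mul1r.
rewrite cd_mul_conjr cd_ipZr -!cd_re_ip -[cd_ip (cd_conj _) w]cd_ip_conj cd_conjK; field.
exact: w0.
Qed.

End Line.

Lemma mx_inner_e00 (A : M) : mx_inner A (cd_e00 R k n) = cd_re (A 0 0).
Proof.
rewrite /mx_inner (bigD1 0)//= [X in _ + X]big1 ?addr0 => [|i /negPf i0].
  rewrite (bigD1 0)//= mxE eqxx /= -cd_re_ip big1 ?addr0// => l /negPf l0.
  by rewrite mxE l0 cd_ip0r.
by rewrite big1// => l _; rewrite mxE i0 cd_ip0r.
Qed.

End ProjectiveLines.

Section ProjectiveGamma.
Variables (R : realType) (k n : nat).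
Hypotheses (kn : (k <= 2)%N \/ (k <= 3)%N /\ n = 2%N) (n0 : (0 < n)%N).
Notation cd := (cd R k).
Notation T := (projective R k n).

Let k3 : (k <= 3)%N. Proof. by case: kn => [/leqW|[]]. Qed.

Let s (A B : T) : R := mx_inner (val A) (val B).

Let innerE (A B : T) : cd_inner (val A) (val B) = s A B.
Proof. by apply: cd_innerE; case/and3P: (valP B). Qed.

Let sC A B : s A B = s B A.
Proof. by apply: eq_bigr => i _; apply: eq_bigr => j _; exact: cd_ipC. Qed.

Let s1 A : s A A = 1. Proof. exact: projector_norm (valP A). Qed.

Let dist2 (A B : T) : \sum_i \sum_j cd_ip (val A i j - val B i j) (val A i j - val B i j)
  = 2 - 2 * s A B.
Proof.
transitivity (s A A + s B B - 2 * s A B); last by rewrite !s1; ring.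
rewrite /s /mx_inner mulr_sumr -sumrN -!big_split; apply: eq_bigr => i _ /=.
rewrite mulr_sumr -sumrN -!big_split; apply: eq_bigr => j _ /=.
rewrite !(cd_ipDl, cd_ipDr, cd_ipNl, cd_ipNr) (cd_ipC (val B i j)); ring.
Qed.

Let transitive_inner (A B : T) : exists g : T -> T,
  [/\ bijective g, forall X Y, s (g X) (g Y) = s X Y & g A = B].
Proof. exact: congruent_all. Qed.

Let s01 A B : 0 <= s A B <= 1.
Proof.
have [g [_ gs gB]] := transitive_inner B point.
apply/andP; split.
  by rewrite -gs gB /s mx_inner_e00; exact: projector_diag_ge0 (valP _) _.
have : 0 <= 2 - 2 * s A B by rewrite -dist2 !sumr_ge0// => i _; rewrite sumr_ge0// => j _; exact: cd_ip_ge0.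
lra.
Qed.

Let sqrt_s A B : 0 <= Num.sqrt (s A B) <= 1.
Proof.
have /andP[s0 sle] := s01 A B.
by rewrite sqrtr_ge0 -[leRHS]sqrtr1 ler_sqrt.
Qed.

Let theta_itv (A B : T) : 0 <= projective_dist A B <= pi.
Proof.
have /andP[t0 t1] := sqrt_s A B; rewrite /projective_dist innerE.
have tI : -1 <= Num.sqrt (s A B) <= 1 by rewrite t1 andbT; lra.
have a0 := acos_ge0 tI; have ap := acos_lepi tI.
rewrite mulr_ge0//= leNgt; apply/negP => h.
have := @ltr_cos R (pi / 2) (acos (Num.sqrt (s A B))).
rewrite !in_itv /= a0 ap cos_pihalf acosK ?in_itv//.
have := pi_ge0 R => p0 /(_ _ erefl) E.
by have := E _; rewrite [0 > _]ltNge t0 /= => {}E; lra.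
Qed.

Let cos_theta (A B : T) : cos (projective_dist A B) = 2 * s A B - 1.
Proof.
have /andP[t0 t1] := sqrt_s A B; have /andP[s0 _] := s01 A B.
rewrite /projective_dist innerE mulr_natl cos_mulr2n acosK ?sqr_sqrtr ?mulr_natl//.
by rewrite in_itv /= t1 andbT; lra.
Qed.

Let s_isometry g : isometry (@projective_dist R k n) g ->
  forall x y, s (g x) (g y) = s x y.
Proof.
move=> [_ ig] x y; have := cos_theta (g x) (g y); rewrite ig cos_theta; lra.
Qed.

Let transitive (A B : T) : exists2 g, isometry (@projective_dist R k n) g & g A = B.
Proof.
have [g [bg gs gA]] := transitive_inner A B; exists g => //; split=> // x y.
by rewrite /projective_dist !innerE gs.
Qed.

Let entry_le (F : 'I_n.+1 -> 'I_n.+1 -> cd) i j c :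
  cd_ip (F i j) c ^+ 2 <= (\sum_i \sum_j cd_ip (F i j) (F i j)) * cd_ip c c.
Proof.
apply: le_trans (cd_cauchy_schwarz _ _) _; apply: ler_wpM2r; first exact: cd_ip_ge0.
have ge i' j' : 0 <= cd_ip (F i' j') (F i' j') by exact: cd_ip_ge0.
rewrite (bigD1 i)//= (bigD1 j)//= -addrA lerDl addr_ge0// ?sumr_ge0//.
by move=> l _; rewrite sumr_ge0.
Qed.

Let tame_entry i j c :
  tame (fun A : borel (@projective_dist R k n) => cd_ip (val (A : T) i j) c).
Proof.
split.
  apply: (measurable_theta_continuous theta_itv cos_theta (C := 2 * cd_ip c c)).
    by rewrite mulr_ge0// cd_ip_ge0.
  move=> A B; rewrite -cd_ipNl -cd_ipDl.
  apply: le_trans (entry_le (fun i j => val A i j - val B i j) i j c) _.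
  by rewrite dist2 le_eqVlt; apply/orP; left; apply/eqP; ring.
exists (Num.sqrt (cd_ip c c)) => A; rewrite -sqrtr_sqr ler_sqrt ?cd_ip_ge0//.
apply: le_trans (entry_le (fun i j => val (A : T) i j) i j c) _.
by rewrite [X in X * _](s1 A) mul1r.
Qed.

Let tame_s (B : T) : tame (fun A : borel (@projective_dist R k n) => s A B).
Proof. by apply: tame_sum => i; apply: tame_sum => j; exact: tame_entry. Qed.

Let s_measurable : measurable_fun
  [set: borel (@projective_dist R k n) * borel (@projective_dist R k n)]
  (fun z : borel (@projective_dist R k n) * borel (@projective_dist R k n) => s z.1 z.2).
Proof.
apply: measurable_sum => i; apply: measurable_sum => j.
under eq_fun do rewrite -cd_parseval.
apply: measurable_sum => e; have [m _] := tame_entry i j e.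
by apply: measurable_funM; [exact: measurableT_comp m measurable_fst
  | exact: measurableT_comp m measurable_snd].
Qed.

Let sum_index (F : 'I_n -> cd -> R) :
  \sum_(i : 'I_n * 'I_(2 ^ k)) F i.1 (nth 0 (cd_basis R k) i.2)
    = \sum_j \sum_(e <- cd_basis R k) F j e.
Proof.
rewrite -(pair_bigA _ (fun j (m : 'I_(2 ^ k)) => F j (nth 0 (cd_basis R k) m))); apply: eq_bigr => j _.
by rewrite (big_nth 0) size_cd_basis big_mkord.
Qed.

Theorem projective_gamma (mu : probability (borel (@projective_dist R k n)) R) :
  invariant_measure mu -> gamma mu = Num.sqrt pi / 4 * (n * 2 ^ k + 2 ^ k)%:R *
    (Gamma ((2 ^ k)%:R / 2) / Gamma (((2 ^ k)%:R + 1) / 2)).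
Proof.
move=> inv; pose e m := nth 0 (cd_basis R k) m.
pose I := ('I_n * 'I_(2 ^ k))%type.
have e1 (i : I) : cd_ip (e i.2) (e i.2) = 1.
  by apply: cd_basis_unit; apply: mem_nth; rewrite size_cd_basis.
pose c (i : I) z : T := exist _ (line i.1 (cd_scale z (cd_conj (e i.2)))) (line_projector _ _ k3).
have pointE x : s x point = cd_re (val x 0 0) by exact: mx_inner_e00.
have curve i z x : (1 + z ^+ 2) * s x (c i z)
    = s x point + 2 * cd_ip (val x 0 (lift 0 i.1)) (e i.2) * z
      + cd_re (val x (lift 0 i.1) (lift 0 i.1)) * z ^+ 2.
  have w2 : cd_ip (cd_scale z (cd_conj (e i.2))) (cd_scale z (cd_conj (e i.2))) = z ^+ 2.
    by rewrite cd_ipZl cd_ipZr cd_ip_conj e1; ring.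
  rewrite -[in LHS]w2 mx_inner_line ?w2; last exact: valP.
  by rewrite pointE cd_conjZ cd_conjK cd_ipZr; ring.
have p0 : (0 < 2 ^ k)%N by rewrite expn_gt0.
have d1 : (2 ^ k).-1.+1 = (2 ^ k)%N by rewrite prednK.
have d2 : (n * 2 ^ k).-1.+1 = (n * 2 ^ k)%N by rewrite prednK// muln_gt0 n0.
have H := @homogeneous_curve_moments R T (@projective_dist R k n) mu s point I
  (fun i x => cd_ip (val x 0 (lift 0 i.1)) (e i.2))
  (fun i x => cd_re (val x (lift 0 i.1) (lift 0 i.1))) c (2 ^ k).-1 (n * 2 ^ k).-1 inv tame_s
  s_isometry transitive _ _ curve.
have := @gamma_of_moments R T (@projective_dist R k n) mu s (2 ^ k).-1 (n * 2 ^ k).-1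
  s01 sC s_measurable theta_itv cos_theta.
rewrite -addSn -addnS d1 d2 -[(2 ^ k).+1%:R]natr1 addnC => -> // y m; apply: H => //.
- by move=> i; under eq_fun do rewrite cd_re_ip; exact: tame_entry.
- move=> x; rewrite (sum_index (fun j _ => cd_re (val x (lift 0 j) (lift 0 j)))) d1 pointE.
  have -> : 1 - cd_re (val x 0 0) = \sum_j cd_re (val x (lift 0 j) (lift 0 j)).
    by have := projector_trace (valP x); rewrite big_ord_recl; lra.
  rewrite mulr_sumr.
  by apply: eq_bigr => j _; rewrite big_const_seq count_predT size_cd_basis iter_addr_0 mulr_natl.
- move=> x; rewrite (sum_index (fun j f => cd_ip (val x 0 (lift 0 j)) f ^+ 2)) pointE.
  under eq_bigr do under eq_bigr do rewrite expr2.
  under eq_bigr do rewrite cd_parseval.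
  have := projector_row (valP x) 0; rewrite big_ord_recl.
  rewrite [X in cd_ip X X](projector_diag (valP x)) cd_ipZl cd_ipZr cd_ip_one.
  by move=> /eqP; rewrite addrC eq_sym -subr_eq => /eqP <-; ring.
- by rewrite card_prod !card_ord d2.
Qed.

End ProjectiveGamma.

Theorem theorem1p2 (R : realType) (Q : rank_one_space) (hQ : admissible Q)
    (mu : probability (borel (@dist R Q)) R) (hmu : invariant_measure mu) :
  let d : R := (param_d Q)%:R in
  let d0 : R := (param_d0 Q)%:R in
  [/\ gamma mu
        = Num.sqrt pi / 4 * (d + d0) * (Gamma (d0 / 2) / Gamma ((d0 + 1) / 2)),
      forall nu : probability (borel (@dist R (Sphere (param_d0 Q)))) R,
        invariant_measure nu ->
        gamma mu = (d + d0) / (2 * d0) * gamma nu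
    & forall (k : nat) (nu : probability (borel (@dist R (Sphere k))) R),
        (1 <= k)%N -> invariant_measure nu ->
        gamma nu
          = k%:R * Num.sqrt pi * Gamma (k%:R / 2)
            / (2 * Gamma ((k%:R + 1) / 2))].

Proof.
have half (k : nat) (nu : probability (borel (@dist R (Sphere k))) R) : (1 <= k)%N ->
    invariant_measure nu -> gamma nu = k%:R * Num.sqrt pi * Gamma (k%:R / 2)
      / (2 * Gamma ((k%:R + 1) / 2)).
  move=> k1 inv; rewrite [LHS](sphere_gamma k1 inv) natrD invfM.
  by move: (Gamma _) (Gamma _)^-1 => x y; field.
have main : (0 < param_d0 Q)%N /\ gamma mu = Num.sqrt pi / 4 *
    (param_d Q + param_d0 Q)%:R *
    (Gamma ((param_d0 Q)%:R / 2) / Gamma (((param_d0 Q)%:R + 1) / 2)).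
  case: Q hQ mu hmu {half} => [d d1|F n [n2 FO]] mu hmu; split=> //.
  - exact: sphere_gamma.
  - by rewrite /= expn_gt0.
  - apply: projective_gamma => //; last exact: ltnW.
    by case: F FO {mu hmu} => FO; [left..|right; split=> //; exact: FO].
move=> d d0; have [p0 E] := main; split=> [|nu inv|]; last exact: half.
- by rewrite E natrD.
- rewrite (half _ _ p0 inv) E natrD !invfM -/d -/d0.
  have : d0 != 0 by rewrite pnatr_eq0 -lt0n.
  by move: d d0 (Gamma _) (Gamma _)^-1 => {}d {}d0 x y d00; field.
Qed.
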